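(* Let $A_n(\rho)$ be an $n\times n$ matrix whose entries are analytic functions of $\rho$, and let $\rho(\mu)$ and $\lambda(\mu)$ be analytic functions in a region $D\subset\mathbb{C}$ such that $A_n(\rho(\mu))$ has the eigenvalue $\lambda(\mu)$ for all $\mu\in D$. Let $A_n(\rho_c)=A_n(\rho(\mu_c))$ possess the double eigenvalue $\lambda_c=\lambda(\mu_c)$, where $\mu_c\in D$, $\rho_c=\rho(\mu_c)$ and $\rho_c,\lambda_c\in\mathbb{C}$. Denote $\lambda_c'=\lambda'(\mu_c)$, $\lambda_c''=\lambda''(\mu_c)$, $\rho_c'=\rho'(\mu_c)$, $\rho_c''=\rho''(\mu_c)$, $\rho_c'''=\rho'''(\mu_c)$ (derivatives with respect to $\mu$) and assume $$\lambda_c'\neq 0,\quad \rho_c'=0,\quad \rho_c''\neq 0 .$$ Then the double-valued function $\lambda(\rho)$ possesses a Puiseux series about the point $\rho=\rho_c$, given by $$\lambda(\rho)=\lambda_c\pm\alpha\epsilon^{1/2}+\beta\epsilon+O\left(\epsilon^{3/2}\right),\quad \epsilon=\rho-\rho_c\to 0,$$ with $$\alpha=\lambda_c'\sqrt{\frac{2}{\rho_c''}}\neq 0$$ (in which the choice of square root is arbitrary) and $$\beta=\frac{3\lambda_c''\rho_c''-\lambda_c'\rho_c'''}{3(\rho_c'')^2}.$$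
   Context: Here the double-valued function $\lambda(\rho)$ is obtained by eliminating $\mu$ near $\mu_c$ from $\lambda=\lambda(\mu)$, $\rho=\rho(\mu)$; its two values are the two eigenvalues of $A_n(\rho)$ that coalesce to $\lambda_c$ at $\rho=\rho_c$. A Puiseux series here means a convergent series in nonnegative integer powers of $\epsilon^{1/2}$ (i.e. $\lambda$ is an analytic function of the variable $\epsilon^{1/2}$ near $0$), the $\pm$ sign corresponding to the two values of $\epsilon^{1/2}$. ''Double eigenvalue'' means an eigenvalue of algebraic multiplicity $2$. *)

(* Defs.v *)
From mathcomp Require Import all_boot all_order all_algebra complex.
From mathcomp Require Import all_classical all_reals all_analysis.
Import Order.TTheory GRing.Theory Num.Theory.
Import numFieldNormedType.Exports.

Set Implicit Arguments.
Unset Strict Implicit.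
Unset Printing Implicit Defensive.

Local Open Scope classical_set_scope.
Local Open Scope ring_scope.

(* The complex field seen as a numFieldType, so that the canonical topology and
   normed module structures of a numFieldType over itself apply: [derive1] on
   functions [Cplx R -> Cplx R] is the complex derivative. *)
Definition Cplx (R : realType) : numFieldType := R[i].

Definition analytic_at (R : realType) (f : Cplx R -> Cplx R) (z0 : Cplx R) : Prop :=
  exists a : nat -> Cplx R,
    \forall z \near z0, series (fun k => a k * (z - z0) ^+ k) @ \oo --> f z.

Definition analytic_on (R : realType) (f : Cplx R -> Cplx R)
    (U : set (Cplx R)) : Prop :=
  forall z, U z -> analytic_at f z.

Definition region (R : realType) (D : set (Cplx R)) : Prop :=
  [/\ D !=set0, open D & connected D].

Definition alg_mult (R : realType) (n : nat) (M : 'M[Cplx R]_n) (x : Cplx R) : nat :=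
  mup x (char_poly M).

(* The values of the multivalued function lambda(z) obtained by eliminating mu,
   restricted to V, from lambda = lambda(mu), z = rho(mu). *)
Definition eliminate (R : realType) (lambda rho : Cplx R -> Cplx R)
    (V : set (Cplx R)) (z : Cplx R) : set (Cplx R) :=
  [set lambda mu | mu in V `&` [set mu | rho mu = z]].

(* [L] uniformizes the double-valued function lambda(rho) near [mu_c]: with
   epsilon = s ^+ 2, the two square roots of epsilon being s and - s, the values
   of lambda(rho_c + epsilon) are L s and L (- s).  The set of values does not
   depend on the neighbourhood V of mu_c once V is small enough. *)
Definition elimination_branches (R : realType) (D : set (Cplx R))
    (lambda rho : Cplx R -> Cplx R) (mu_c : Cplx R) (L : Cplx R -> Cplx R) : Prop :=
  exists V0 : set (Cplx R), [/\ nbhs mu_c V0, V0 `<=` D &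
    forall V : set (Cplx R), nbhs mu_c V -> V `<=` V0 ->
      \forall s \near (0 : Cplx R),
        eliminate lambda rho V (rho mu_c + s ^+ 2) = [set L s; L (- s)]].

(* L s and L (- s) are exactly the eigenvalues of A (rho_c + s ^+ 2) which tend
   to lambda_c as s tends to 0, and they are distinct for s != 0. *)
Definition coalescing_eigenvalues (R : realType) (n : nat)
    (A : Cplx R -> 'M[Cplx R]_n) (rho_c lambda_c : Cplx R)
    (L : Cplx R -> Cplx R) : Prop :=
  (exists W0 : set (Cplx R), nbhs lambda_c W0 /\
    forall W : set (Cplx R), nbhs lambda_c W -> W `<=` W0 ->
      \forall s \near (0 : Cplx R),
        W `&` [set x | eigenvalue (A (rho_c + s ^+ 2)) x] = [set L s; L (- s)])
  /\ (\forall s \near (0 : Cplx R)^', L s != L (- s)).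

(* Main.v *)
(* Write [rho(mu_c + t) = rho_c + t^2 g(t)] with [g(0) = rho_c''/2]. The equation
   [rho = rho_c + s^2] is solved by [t = phi(s) = s v(s)] with [v(s)^2 g(s v(s)) = 1]
   and [v(0) = w]: [v] is found as a formal power series by a fixed-point
   iteration on truncations, and the weighted l^1 norms of the iterates stay
   bounded at a small radius, which gives convergence. The branch is
   [L = lambda o phi]. Solutions [t] near 0 are only [phi(s)] and [phi(-s)],
   since three of them would contradict [rho_c'' != 0]. Finally
   [(X - L(s)) (X - L(-s))] divides the characteristic polynomial of
   [A(rho_c + s^2)], and the quotient depends continuously on [s] and does not
   vanish at [lambda_c] for [s = 0], so no other eigenvalue tends to [lambda_c]. *)

Require Import Defs.
From mathcomp Require Import all_boot all_order all_algebra complex.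
From mathcomp Require Import all_classical all_reals all_analysis.
From mathcomp Require Import perm ring lra.
Import Order.TTheory GRing.Theory Num.Theory.
Import numFieldNormedType.Exports.

Set Implicit Arguments.
Unset Strict Implicit.
Unset Printing Implicit Defensive.

Local Open Scope classical_set_scope.
Local Open Scope ring_scope.

(** The obstacle is composition: both [v] and [lambda o phi] must come out as power series, and the
    sums of these series must be the actual values of the composed functions. Rearranging multiple
    series is avoided by presenting each formal series through polynomials that agree modulo ['X^n]
    from rank [n] on and share one bound at one radius. Algebraic facts become congruences modulo
    ['X^n], analytic facts become one majorant estimate, and [stabilizing_cvg] turns the two into
    convergence of values to the sum of a power series. Identities between functions are then
    obtained by computing the limit of one polynomial sequence in two ways. The condition v(0)^2
    g(0) = 1 reads w^2 = 2 / rho_c'', so alpha = lambda_c' w is the linear coefficient of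
    lambda(mu_c + phi(s)). The term rho_c''' of beta enters through the coefficient of s in [v],
    which is -w^4 g_1 / 2. *)

Definition cmod (R : realType) (z : Cplx R) : R := Normc.normc (z : R[i]).
Arguments cmod : simpl never.

(** * The complex modulus with real values, and limits expressed through it *)

Section Modulus.
Variable R : realType.
Local Notation C := (Cplx R).
Implicit Types x y z : C.

Lemma cmodE z : `|z| = ((cmod z)%:C)%C :> R[i].
Proof. by case: z => a b. Qed.

Lemma cmodM x y : cmod (x * y) = cmod x * cmod y.
Proof. exact: Normc.normcM. Qed.

Lemma cmod1 : cmod (1 : C) = 1.
Proof. exact: Normc.normc1. Qed.

Lemma cmod0 : cmod (0 : C) = 0.
Proof. exact: Normc.normc0. Qed.

Lemma cmod_eq0 z : (cmod z == 0) = (z == 0).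
Proof.
by apply/eqP/eqP => [|->]; [exact: (@Normc.eq0_normc R z) | exact: cmod0].
Qed.

Lemma cmodV z : cmod z^-1 = (cmod z)^-1.
Proof. exact: Normc.normcV. Qed.

Lemma cmodN z : cmod (- z) = cmod z.
Proof. exact: (@normcN R z). Qed.

Lemma cmodB x y : cmod (x - y) = cmod (y - x).
Proof. by rewrite -cmodN opprB. Qed.

Lemma cmodD x y : cmod (x + y) <= cmod x + cmod y.
Proof. exact: le_normcD. Qed.

Lemma cmod_ge0 z : 0 <= cmod z.
Proof. by case: z => a b; exact: sqrtr_ge0. Qed.

Lemma cmod_gt0 z : (0 < cmod z) = (z != 0).
Proof. by rewrite lt_def cmod_ge0 andbT cmod_eq0. Qed.

Lemma cmodX z n : cmod (z ^+ n) = cmod z ^+ n.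
Proof. by elim: n => [|n IH]; rewrite ?expr0 ?cmod1 // !exprS cmodM IH. Qed.

Lemma cmod_triangle x y z : cmod (x - z) <= cmod (x - y) + cmod (y - z).
Proof. by have := cmodD (x - y) (y - z); rewrite addrA subrK. Qed.

Lemma cmod_natr n : cmod (n%:R : C) = n%:R.
Proof.
rewrite -[n%:R : C](rmorph_nat (real_complex R)) /cmod /= expr0n addr0.
by rewrite sqrtr_sqr ger0_norm.
Qed.

Lemma cmod_real (e : R) : 0 <= e -> cmod (e%:C)%C = e.
Proof.
by move=> e0; rewrite /cmod /= expr0n addr0 sqrtr_sqr ger0_norm.
Qed.

Lemma cmod_sum (I : Type) (s : seq I) (P : pred I) (F : I -> C) :
  cmod (\sum_(i <- s | P i) F i) <= \sum_(i <- s | P i) cmod (F i).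
Proof.
elim/big_ind2: _ => [|x u y v ux vy|//]; first by rewrite cmod0.
by rewrite (le_trans (cmodD _ _)) // lerD.
Qed.

Lemma cmod_lt (e : R) z : (`|z| < (e%:C)%C :> R[i]) = (cmod z < e).
Proof. by rewrite cmodE ltcR. Qed.

(** The order of the complex field is partial and its positive elements are real; radii of balls,
    which are complex numbers here, can thus be replaced by real ones. *)
Lemma cplx_gt0 (e : C) : 0 < e -> exists2 e' : R, 0 < e' & e = (e'%:C)%C.
Proof.
move=> e0; have /complex_realP [k ek] : (e : R[i]) \is Num.real.
  exact: gtr0_real.
by exists k => //; rewrite -ltcR -ek.
Qed.

Lemma nbhs_cmodP (z : C) (P : set C) :
  nbhs z P <-> exists2 e : R, 0 < e & forall y, cmod (y - z) < e -> P y.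
Proof.
split=> [/nbhs_normP [e /= /cplx_gt0 [e' e'0 ->] He]|[e e0 He]].
  by exists e' => // y yz; apply: He => /=; rewrite cmod_lt cmodB.
apply/nbhs_normP; exists ((e%:C)%C : C) => /=; first by rewrite ltcR.
by move=> y /=; rewrite cmod_lt cmodB; exact: He.
Qed.

Lemma dnbhs_cmodP (z : C) (P : set C) :
  z^' P <-> exists2 e : R, 0 < e & forall y, y != z -> cmod (y - z) < e -> P y.
Proof.
rewrite /dnbhs /within /=; split=> [/nbhs_cmodP|] [e e0 He].
  by exists e => // y yz ?; exact: He.
by apply/nbhs_cmodP; exists e => // y ? ?; exact: He.
Qed.

Lemma cvg_cmodP (T : Type) (F : set_system T) (FF : Filter F) (f : T -> C)
    (l : C) :
  f @ F --> l <-> forall e : R, 0 < e -> \forall x \near F, cmod (f x - l) < e.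
Proof.
split=> [/cvgrPdist_lt H e e0|H].
  have e0' : 0 < ((e%:C)%C : C) by rewrite ltcR.
  by have := H _ e0'; apply: filterS => x; rewrite cmod_lt cmodB.
apply/cvgrPdist_lt => e /cplx_gt0 [e' e'0 ->].
by apply: filterS (H _ e'0) => x; rewrite cmod_lt cmodB.
Qed.

Lemma cvgn_cmodP (u : nat -> C) (l : C) :
  u @ \oo --> l <->
  forall e : R, 0 < e -> exists N, forall n, (N <= n)%N -> cmod (u n - l) < e.
Proof.
rewrite (cvg_cmodP _); split=> H e /H.
  by case=> N _ HN; exists N => n Nn; apply: HN.
by case=> N HN; exists N.
Qed.

Lemma cvgn_cmod_unique (u : nat -> C) (l l' : C) :
  u @ \oo --> l -> u @ \oo --> l' -> l = l'.
Proof.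
move=> ul ul'; rewrite -(cvg_lim (@norm_hausdorff _ _) ul).
by apply: (cvg_lim (@norm_hausdorff _ _)); exact: ul'.
Qed.

Lemma cvgn_cmod_le (u : nat -> C) (l x : C) (B : R) :
  u @ \oo --> l -> (exists N, forall n, (N <= n)%N -> cmod (u n - x) <= B) ->
  cmod (l - x) <= B.
Proof.
move=> /cvgn_cmodP ul [N HN]; apply/ler_addgt0Pr => e /ul [M HM].
rewrite (le_trans (cmod_triangle _ (u (maxn N M)) _)) // addrC lerD //.
  by apply: HN; exact: leq_maxl.
by rewrite cmodB ltW // HM // leq_maxr.
Qed.

Lemma cvgn_geometric_bound (u : nat -> C) (l : C) (K q : R) :
  0 <= q < 1 -> (forall n, cmod (u n - l) <= K * q ^+ n) -> u @ \oo --> l.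
Proof.
move=> /andP[q0 q1] Hu; apply/cvgn_cmodP => e e0.
have : geometric K q @ \oo --> (0 : R).
  by apply: cvg_geometric; rewrite ger0_norm.
move=> /cvgrPdist_lt /(_ e e0) [N _ HN]; exists N => n Nn.
apply: le_lt_trans (Hu n) _.
by have := HN n Nn; rewrite /= sub0r normrN; apply: le_lt_trans; exact: ler_norm.
Qed.

Lemma cmod_bounded_by_parts (z : C) :
  `|complex.Re z| <= cmod z /\ `|complex.Im z| <= cmod z.
Proof.
case: z => a b; rewrite /cmod /= -!sqrtr_sqr.
by split; apply: ler_wsqrtr; rewrite ?lerDl ?lerDr sqr_ge0.
Qed.

Lemma cmod_le_parts (z : C) : cmod z <= `|complex.Re z| + `|complex.Im z|.
Proof.
case: z => a b; rewrite /cmod /=.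
have h0 : 0 <= `|a| + `|b| by rewrite addr_ge0.
rewrite -[leRHS]ger0_norm // -sqrtr_sqr; apply: ler_wsqrtr.
rewrite sqrrD !real_normK ?num_real // addrAC lerDl.
by rewrite mulrn_wge0 // mulr_ge0.
Qed.

End Modulus.

(** * Power series with geometrically bounded coefficients *)

Section PowerSeries.
Variable R : realType.
Local Notation C := (Cplx R).
Implicit Types (a b : nat -> C) (z h : C) (K r : R).

(** Cauchy's estimates, taken as the definition of a positive radius of convergence. [K] and [r]
    stay explicit because the later majorants compute with them. *)
Definition geo_bounded a K r := 0 < r /\ forall k, cmod (a k) * r ^+ k <= K.

(** Where the series diverges, [lim] gives a default value; the lemmas below therefore ask for a
    margin such as [2 * cmod z <= r]. It makes the ratio of the majorant at most 1/2, so a tail is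
    at most twice its first bound. *)
Definition psum a z : C := lim (series (fun k => a k * z ^+ k) @ \oo).

Lemma geo_bounded_ge0 a K r : geo_bounded a K r -> 0 <= K.
Proof. by case=> r0 /(_ 0%N); apply: le_trans; rewrite mulr1 cmod_ge0. Qed.

Lemma geo_boundedW a K r s : 0 < s -> s <= r -> geo_bounded a K r ->
  geo_bounded a K s.
Proof.
move=> s0 sr [r0 H]; split=> // k; apply: le_trans (H k).
by rewrite ler_wpM2l ?cmod_ge0 // lerXn2r // nnegrE ltW.
Qed.

Lemma geo_bounded_term a K r z k : geo_bounded a K r ->
  cmod (a k * z ^+ k) <= K * (cmod z / r) ^+ k.
Proof.
move=> [r0 H]; rewrite cmodM cmodX expr_div_n mulrA mulrAC ler_wpM2r //.
  by rewrite exprn_ge0 // cmod_ge0.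
by rewrite ler_pdivlMr ?exprn_gt0.
Qed.

Lemma series_partial_bound (u : nat -> C) K (q : R) N M : 0 <= q -> 2 * q <= 1 ->
  0 <= K -> (forall k, cmod (u k) <= K * q ^+ k) -> (N <= M)%N ->
  cmod (series u M - series u N) <= 2 * K * q ^+ N.
Proof.
move=> q0 q1 K0 Hu NM.
(* The subtracted power makes the bound inductive: passing from [M] to [M.+1] uses [2 * q <= 1]
   once. *)
suff: cmod (series u M - series u N) <= 2 * K * (q ^+ N - q ^+ M).
  move/le_trans; apply; rewrite mulrBr gerBl mulr_ge0 ?exprn_ge0 //.
  by rewrite mulr_ge0.
elim: M NM => [|M IH]; first by rewrite leqn0 => /eqP ->; rewrite !subrr cmod0 mulr0.
rewrite leq_eqVlt => /predU1P[->|]; first by rewrite !subrr cmod0 mulr0.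
rewrite ltnS => /IH {}IH.
have -> : series u M.+1 = series u M + u M.
  by rewrite /series /= big_nat_recr.
rewrite addrAC (le_trans (cmodD _ _)) //.
apply: le_trans (lerD IH (Hu M)) _.
have : 0 <= K * q ^+ M by rewrite mulr_ge0 ?exprn_ge0.
rewrite exprS; nra.
Qed.

Lemma real_series_cvg (v : nat -> R) K (q : R) : 0 <= q < 1 ->
  (forall k, `|v k| <= K * q ^+ k) -> cvgn (series v).
Proof.
move=> /andP[q0 q1] Hv; apply: normed_cvg.
apply: (@series_le_cvg _ _ (geometric K q)) => //= [k|].
  by apply: le_trans (Hv k).
by apply: is_cvg_geometric_series; rewrite ger0_norm.
Qed.

(** Real and imaginary parts are each dominated by the same real geometric series, and the limit is
    assembled from theirs. *)
Lemma series_geo_cvg (u : nat -> C) K (q : R) : 0 <= q < 1 ->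
  (forall k, cmod (u k) <= K * q ^+ k) -> cvgn (series u).
Proof.
move=> q01 Hu.
have HR : cvgn (series (fun k => complex.Re (u k))).
  apply: (real_series_cvg q01) => k.
  by apply: le_trans (Hu k); case: (cmod_bounded_by_parts (u k)).
have HI : cvgn (series (fun k => complex.Im (u k))).
  apply: (real_series_cvg q01) => k.
  by apply: le_trans (Hu k); case: (cmod_bounded_by_parts (u k)).
pose l : C := Complex (lim (series (fun k => complex.Re (u k)) @ \oo))
   (lim (series (fun k => complex.Im (u k)) @ \oo)).
apply/cvg_ex; exists l; apply/cvgn_cmodP => e e0.
move: HR HI => /cvgrPdist_lt /(_ (e / 2)) HR /cvgrPdist_lt /(_ (e / 2)) HI.
have e20 : 0 < e / 2 by rewrite divr_gt0.
have [N _ HN] := HR e20; have [M _ HM] := HI e20.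
exists (maxn N M) => n; rewrite geq_max => /andP[Nn Mn].
apply: le_lt_trans (cmod_le_parts _) _.
have {HN}/= := HN n Nn; have {HM}/= := HM n Mn.
have ReE : complex.Re (series u n) = series (fun k => complex.Re (u k)) n.
  rewrite /series /=; elim: n {Nn Mn} => [|n IH]; first by rewrite !big_nil.
  by rewrite !big_nat_recr //= -IH; case: (\sum_(_ <= _ < _) _); case: (u n).
have ImE : complex.Im (series u n) = series (fun k => complex.Im (u k)) n.
  rewrite /series /=; elim: n {Nn Mn ReE} => [|n IH]; first by rewrite !big_nil.
  by rewrite !big_nat_recr //= -IH; case: (\sum_(_ <= _ < _) _); case: (u n).
have -> : complex.Re (series u n - l) =
    series (fun k => complex.Re (u k)) n - complex.Re l.
  by rewrite -ReE; case: (series u n); case: l.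
have -> : complex.Im (series u n - l) =
    series (fun k => complex.Im (u k)) n - complex.Im l.
  by rewrite -ImE; case: (series u n); case: l.
rewrite /= ![`|lim _ - _|]distrC => h1 h2.
by rewrite (splitr e) ltrD.
Qed.

Lemma psum_ratio z r : 0 < r -> 2 * cmod z <= r ->
  0 <= cmod z / r /\ 2 * (cmod z / r) <= 1.
Proof.
move=> r0 zr; split; first by rewrite divr_ge0 ?cmod_ge0 // ltW.
by rewrite mulrA ler_pdivrMr // mul1r.
Qed.

Lemma psum_cvg a K r z : geo_bounded a K r -> 2 * cmod z <= r ->
  series (fun k => a k * z ^+ k) @ \oo --> psum a z.
Proof.
move=> Ha zr; have [q0 q1] := psum_ratio (proj1 Ha) zr.
apply: (@series_geo_cvg _ K (cmod z / r)); first by apply/andP; split; lra.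
by move=> k; exact: geo_bounded_term.
Qed.

Lemma psum_tail a K r z N : geo_bounded a K r -> 2 * cmod z <= r ->
  cmod (psum a z - series (fun k => a k * z ^+ k) N) <=
    2 * K * (cmod z / r) ^+ N.
Proof.
move=> Ha zr; have [q0 q1] := psum_ratio (proj1 Ha) zr.
apply: (cvgn_cmod_le (psum_cvg Ha zr)); exists N => n Nn.
apply: series_partial_bound => // [|k]; first exact: geo_bounded_ge0 Ha.
exact: geo_bounded_term.
Qed.

Lemma psum_le a K r z : geo_bounded a K r -> 2 * cmod z <= r ->
  cmod (psum a z) <= 2 * K.
Proof.
move=> Ha zr; have := psum_tail 0 Ha zr.
by rewrite /series /= big_nil subr0 expr0 mulr1.
Qed.

Lemma psum_at0 a K r : geo_bounded a K r -> psum a 0 = a 0%N.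
Proof.
move=> Ha; have r0 := proj1 Ha.
have zr : 2 * cmod (0 : C) <= r by rewrite cmod0 mulr0 ltW.
have := psum_tail 1 Ha zr; rewrite cmod0 mul0r expr1 mulr0 /series /=.
rewrite big_nat1 expr0 mulr1 => h; apply/eqP; rewrite -subr_eq0 -cmod_eq0.
by rewrite eq_le h cmod_ge0.
Qed.

Lemma geo_bounded_shift a K r : geo_bounded a K r ->
  geo_bounded (fun k => a k.+1) (K / r) r.
Proof.
move=> [r0 H]; split=> // k; rewrite ler_pdivlMr // -mulrA -exprSr.
exact: H.
Qed.

Lemma psum_shift a K r z : geo_bounded a K r -> 2 * cmod z <= r ->
  psum a z = a 0%N + z * psum (fun k => a k.+1) z.
Proof.
move=> Ha zr; apply: (cvg_lim (@norm_hausdorff _ _)).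
have H := psum_cvg (geo_bounded_shift Ha) zr.
rewrite -(cvg_shiftS _).
have -> : [sequence series (fun k => a k * z ^+ k) n.+1]_n =
  (fun n => a 0%N + z * series (fun k => a k.+1 * z ^+ k) n).
  apply/funext => n; rewrite /series /= big_nat_recl // expr0 mulr1.
  rewrite mulr_sumr; congr (_ + _); apply: eq_bigr => k _.
  by rewrite exprS mulrCA.
by apply: cvgD; [exact: cvg_cst | apply: cvgM; [exact: cvg_cst | exact: H]].
Qed.

Definition dcoef a k : C := k.+1%:R * a k.+1.

(** Halving the radius absorbs the factor k + 1, since (k + 1) / 2^k is at most 2. *)
Lemma geo_bounded_dcoef a K r : geo_bounded a K r ->
  geo_bounded (dcoef a) (K / r * 2) (r / 2).
Proof.
move=> [r0 H]; split=> [|k]; first by rewrite divr_gt0.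
rewrite /dcoef cmodM cmod_natr expr_div_n.
have h1 : cmod (a k.+1) * r ^+ k <= K / r.
  by rewrite ler_pdivlMr // -mulrA -exprSr.
have h2 : (k.+1%:R : R) / 2 ^+ k <= 2.
  rewrite ler_pdivrMr ?exprn_gt0 // -exprS -natrX ler_nat.
  exact: ltnW (ltn_expl _ _).
have -> : k.+1%:R * cmod (a k.+1) * (r ^+ k / 2 ^+ k) =
   cmod (a k.+1) * r ^+ k * (k.+1%:R / 2 ^+ k) by ring.
apply: ler_pM => //; rewrite ?divr_ge0 ?mulr_ge0 ?exprn_ge0 ?cmod_ge0 //.
exact: ltW.
Qed.

(** If E_k denotes the second-order remainder of the k-th power, then E_{k+1} = (z + h) E_k + h^2 k
    z^(k-1). The power of 2 swallows the factor k in this recursion, and multiplying by [rho ^+ 2]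
    avoids the exponent k - 2. *)
Lemma pow_taylor2_bound z h (rho : R) k : 0 <= rho -> cmod z <= rho ->
  cmod (z + h) <= rho ->
  cmod ((z + h) ^+ k - z ^+ k - h * (k%:R * z ^+ k.-1)) * rho ^+ 2 <=
  cmod h ^+ 2 * (2 * rho) ^+ k.
Proof.
move=> rho0 zr zhr.
elim: k => [|k IH].
  rewrite !expr0 subrr mul0r mulr0 subrr cmod0 mul0r mulr1.
  by rewrite exprn_ge0 // cmod_ge0.
have -> : (z + h) ^+ k.+1 - z ^+ k.+1 - h * (k.+1%:R * z ^+ k) =
   (z + h) * ((z + h) ^+ k - z ^+ k - h * (k%:R * z ^+ k.-1)) +
   h ^+ 2 * (k%:R * z ^+ k.-1).
  case: k {IH} => [|k] /=; first by rewrite !expr1 !expr0; ring.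
  by rewrite !exprS -[k.+2%:R]natr1; ring.
set E := cmod (_ - _ - _) in IH.
have hk : k%:R * cmod z ^+ k.-1 * rho ^+ 2 <= rho * (2 * rho) ^+ k.
  case: k {IH E} => [|k] /=; first by rewrite !mul0r expr0 mulr1.
  have -> : rho * (2 * rho) ^+ k.+1 = 2 ^+ k.+1 * (rho ^+ k * rho ^+ 2).
    by rewrite exprMn [rho ^+ k.+1]exprS; ring.
  rewrite -mulrA; apply: ler_pM => //.
  - by rewrite mulr_ge0 ?exprn_ge0 ?cmod_ge0.
  - have := ltnW (ltn_expl k.+1 (ltnSn 1)).
    by rewrite -(ler_nat R) natrX.
  - by rewrite ler_wpM2r ?exprn_ge0 // lerXn2r // nnegrE cmod_ge0.
apply: le_trans (ler_wpM2r _ (cmodD _ _)) _; first by rewrite exprn_ge0.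
rewrite !cmodM cmod_natr cmodX -/E -[cmod h * cmod h]expr2 mulrDl.
have -> : cmod h ^+ 2 * (2 * rho) ^+ k.+1 =
  rho * (cmod h ^+ 2 * (2 * rho) ^+ k) + cmod h ^+ 2 * (rho * (2 * rho) ^+ k).
  by rewrite [(_ * _) ^+ k.+1]exprS; ring.
apply: lerD; last first.
  by rewrite -[leLHS]mulrA; apply: ler_wpM2l; rewrite ?exprn_ge0 ?cmod_ge0.
rewrite -mulrA; apply: ler_pM => //; first exact: cmod_ge0.
by rewrite mulr_ge0 ?exprn_ge0 ?cmod_ge0.
Qed.

(** The bound on powers is applied with [rho] equal to r / 4: then (2 rho)^k = (r / 2)^k leaves K /
    2^k from each coefficient. The square of 4 gives 16, and summing the geometric series gives
    32. *)
Lemma psum_taylor2 a K r z h : geo_bounded a K r -> 4 * cmod z <= r ->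
  4 * cmod (z + h) <= r ->
  cmod (psum a (z + h) - psum a z - h * psum (dcoef a) z) <=
  32 * K / r ^+ 2 * cmod h ^+ 2.
Proof.
move=> Ha zr zhr; have [r0 Hak] := Ha.
have z0 := cmod_ge0 z; have zh0 := cmod_ge0 (z + h).
have K0 := geo_bounded_ge0 Ha.
have c1 : series (fun k => a k * (z + h) ^+ k) @ \oo --> psum a (z + h).
  by apply: psum_cvg Ha _; lra.
have c2 : series (fun k => a k * z ^+ k) @ \oo --> psum a z.
  by apply: psum_cvg Ha _; lra.
have c3 : series (fun k => dcoef a k * z ^+ k) @ \oo --> psum (dcoef a) z.
  by apply: psum_cvg (geo_bounded_dcoef Ha) _; lra.
(* The first n terms of the derived series belong to the first n + 1 terms of the original one,
   hence the shift. *)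
rewrite -(cvg_shiftS _) in c1; rewrite -(cvg_shiftS _) in c2.
have c : (fun n => series (fun k => a k * (z + h) ^+ k) n.+1 -
     series (fun k => a k * z ^+ k) n.+1 -
     h * series (fun k => dcoef a k * z ^+ k) n) @ \oo -->
   psum a (z + h) - psum a z - h * psum (dcoef a) z.
  apply: cvgB; first by apply: cvgB; [exact: c1 | exact: c2].
  by apply: cvgM; [exact: cvg_cst | exact: c3].
rewrite -[_ - h * _]subr0; apply: (cvgn_cmod_le c).
exists 0%N => n _; rewrite subr0.
pose E k : C := (z + h) ^+ k - z ^+ k - h * (k%:R * z ^+ k.-1).
have -> : series (fun k => a k * (z + h) ^+ k) n.+1 -
     series (fun k => a k * z ^+ k) n.+1 -
     h * series (fun k => dcoef a k * z ^+ k) n = series (fun k => a k * E k) n.+1.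
  have -> : h * series (fun k => dcoef a k * z ^+ k) n =
      series (fun k => h * (k%:R * a k * z ^+ k.-1)) n.+1.
    rewrite /series /= [RHS]big_nat_recl // !mul0r mulr0 add0r mulr_sumr.
    by apply: eq_bigr.
  rewrite /series /= -!sumrB; apply: eq_bigr => k _; rewrite /E; ring.
have {}Hak : forall k, cmod (a k * E k) <= (16 * K / r ^+ 2 * cmod h ^+ 2) * 2^-1 ^+ k.
  move=> k; have := @pow_taylor2_bound z h (r / 4) k.
  have r4 : 0 <= r / 4 by lra.
  have zr4 : cmod z <= r / 4 by lra.
  have zhr4 : cmod (z + h) <= r / 4 by lra.
  rewrite -/(E k) => /(_ r4 zr4 zhr4) hE.
  rewrite cmodM.
  have r20 : 0 < r ^+ 2 by rewrite exprn_gt0.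
  have -> : 16 * K / r ^+ 2 * cmod h ^+ 2 * 2^-1 ^+ k =
     (K * (16 * cmod h ^+ 2 * 2^-1 ^+ k)) / r ^+ 2 by ring.
  rewrite ler_pdivlMr //.
  have {}hE : cmod (E k) * r ^+ 2 <= 16 * cmod h ^+ 2 * (r * 2^-1) ^+ k.
    have e2 : (r / 4) ^+ 2 = r ^+ 2 / 16 by field.
    rewrite e2 in hE.
    have e3 : 2 * (r / 4) = r * 2^-1 by field.
    rewrite e3 in hE; lra.
  rewrite exprMn in hE; rewrite -[leLHS]mulrA.
  apply: le_trans (ler_wpM2l (cmod_ge0 _) hE) _.
  have -> : cmod (a k) * (16 * cmod h ^+ 2 * (r ^+ k * 2^-1 ^+ k)) =
    cmod (a k) * r ^+ k * (16 * cmod h ^+ 2 * 2^-1 ^+ k) by ring.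
  rewrite ler_wpM2r // mulr_ge0 ?exprn_ge0 // ?invr_ge0 //.
  by rewrite mulr_ge0 // exprn_ge0 // cmod_ge0.
have K'0 : 0 <= 16 * K / r ^+ 2 * cmod h ^+ 2.
  by rewrite mulr_ge0 ?exprn_ge0 ?cmod_ge0 // divr_ge0 ?exprn_ge0 // ?mulr_ge0 // ltW.
have q0 : 0 <= 2^-1 :> R by lra.
have q1 : 2 * 2^-1 <= 1 :> R by lra.
have := series_partial_bound q0 q1 K'0 Hak (leq0n n.+1).
rewrite [series _ 0%N]/series /= big_nil subr0 expr0 mulr1.
by move/le_trans; apply; lra.
Qed.

Lemma derive1_of_quadratic_error (f : C -> C) z (d : C) (B e : R) :
  0 < e -> (forall h, cmod h < e ->
    cmod (f (z + h) - f z - h * d) <= B * cmod h ^+ 2) ->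
  derive1 f z = d.
Proof.
move=> e0 H; apply: (cvg_lim (@norm_hausdorff _ _)).
apply/cvg_cmodP => eps eps0.
have B1 : 0 < `|B| + 1 by rewrite ltr_wpDl.
apply/dnbhs_cmodP; exists (Num.min e (eps / (`|B| + 1))).
  by rewrite lt_min e0 divr_gt0.
move=> h h0; rewrite subr0 lt_min => /andP[he heps].
have ch0 : 0 < cmod h by rewrite cmod_gt0.
have -> : h^-1 *: (f (h + z) - f z) - d = h^-1 * (f (z + h) - f z - h * d).
  rewrite [h + z]addrC -[_ *: _]/(h^-1 * _) [RHS]mulrBr; congr (_ - _).
  by rewrite mulrA mulVf // mul1r.
rewrite cmodM cmodV mulrC ltr_pdivrMr //.
apply: le_lt_trans (H h he) _; rewrite expr2 mulrA ltr_pM2r //.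
rewrite ltr_pdivlMr // in heps; apply: le_lt_trans heps.
rewrite mulrC ler_wpM2l ?cmod_ge0 //.
by rewrite (le_trans (ler_norm _)) // lerDl.
Qed.

(** The expansion is required on a whole disc, so that it passes to [derive1 f] and Taylor
    coefficients can be read off after iteration. *)
Definition has_psum (f : C -> C) (z0 : C) a := exists K r, geo_bounded a K r /\
  forall z, 2 * cmod (z - z0) <= r -> f z = psum a (z - z0).

Lemma has_psum_derive1 f z0 a : has_psum f z0 a ->
  has_psum (derive1 f) z0 (dcoef a).
Proof.
move=> [K [r [Ha fE]]]; have r0 := proj1 Ha.
have r40 : 0 < r / 4 by rewrite divr_gt0.
exists (K / r * 2), (r / 4); split.
  by apply: geo_boundedW (geo_bounded_dcoef Ha) => //; lra.
move=> z zr; have z0' := cmod_ge0 (z - z0).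
apply: (@derive1_of_quadratic_error _ _ _ (32 * K / r ^+ 2) (r / 8)); first lra.
move=> h hr.
have zh : cmod (z - z0 + h) <= cmod (z - z0) + cmod h by exact: cmodD.
have eh : z + h - z0 = z - z0 + h by ring.
rewrite !fE ?eh; [|lra|lra].
by apply: psum_taylor2 => //; lra.
Qed.

Lemma has_psum_at f z0 a : has_psum f z0 a -> f z0 = a 0%N.
Proof.
move=> [K [r [Ha fE]]]; rewrite fE subrr ?(psum_at0 Ha) //.
by rewrite cmod0 mulr0 ltW // (proj1 Ha).
Qed.

Lemma has_psum_derive1n f z0 a n : has_psum f z0 a ->
  derive1n n f z0 = n`!%:R * a n.
Proof.
move=> Hf.
(* The induction needs the full expansion of the n-th derivative, with coefficients (n + k)! / k!
   times [a (n + k)]; the natural-number division is exact by [dv] below. *)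
suff : has_psum (derive1n n f) z0
    (fun k => ((n + k)`! %/ k`!)%:R * a (n + k)%N).
  by move/has_psum_at => ->; rewrite addn0 fact0 divn1.
elim: n => [|n IH].
  have -> : (fun k => ((0 + k)`! %/ k`!)%:R * a (0 + k)%N) = a.
    by apply/funext => k; rewrite divnn fact_gt0 mul1r.
  exact: Hf.
have := has_psum_derive1 IH.
rewrite derive1nS; congr has_psum; apply/funext => k; rewrite /dcoef.
rewrite -addSnnS mulrA -natrM; congr (_%:R * _).
have dv m j : (j`! %| (m + j)`!)%N.
  by rewrite -(@bin_fact (m + j) j) ?leq_addl // mulnCA dvdn_mulr.
have /dvdnP[q E] := dv n k.+1.
by rewrite addSnnS E mulnK ?fact_gt0 // factS mulnA mulnK ?fact_gt0 // mulnC.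
Qed.

(** Convergence at one point at distance e / 2 forces the terms there to tend to 0: they are at most
    1 from some rank on, and [K] adds the finitely many earlier ones. *)
Lemma analytic_at_has_psum f z0 : analytic_at f z0 -> exists a, has_psum f z0 a.
Proof.
move=> [a] /nbhs_cmodP [e e0 Hf]; exists a.
have e20 : 0 < e / 2 by rewrite divr_gt0.
have cE : cmod ((e / 2)%:C)%C = e / 2 by rewrite cmod_real // ltW.
have := Hf (z0 + ((e / 2)%:C)%C); rewrite [z0 + _ - _]addrC addKr cE.
have elt : e / 2 < e by lra.
move=> /(_ elt) /cvgP /cvg_series_cvg_0 /cvgn_cmodP /(_ 1 ltr01) [N HN].
pose K := 1 + \sum_(k < N) cmod (a k) * (e / 2) ^+ k.
have s0 : 0 <= \sum_(k < N) cmod (a k) * (e / 2) ^+ k.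
  by apply: sumr_ge0 => k _; rewrite mulr_ge0 ?cmod_ge0 // exprn_ge0 // ltW.
have Ha : geo_bounded a K (e / 2).
  split=> // k; have [kN|Nk] := ltnP k N.
    rewrite /K (bigD1 (Ordinal kN)) //= addrCA lerDl addr_ge0 //.
    by apply: sumr_ge0 => j _; rewrite mulr_ge0 ?cmod_ge0 // exprn_ge0 // ltW.
  have := HN k Nk; rewrite subr0 cmodM cmodX cE => /ltW/le_trans; apply.
  by rewrite lerDl.
exists K, (e / 2); split=> // z zr; have z0' := cmod_ge0 (z - z0).
symmetry; apply: (cvg_lim (@norm_hausdorff _ _)).
by apply: Hf; lra.
Qed.

Lemma psum_analytic_at a K r : geo_bounded a K r -> analytic_at (psum a) 0.
Proof.
move=> Ha; exists a; apply/nbhs_cmodP; exists (r / 2).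
  by rewrite divr_gt0 // (proj1 Ha).
by move=> z; rewrite subr0 => zr; apply: psum_cvg Ha _; lra.
Qed.

End PowerSeries.

(** * Majorants for polynomials, and composition of truncated series *)

Section Majorants.
Variable R : realType.
Local Notation C := (Cplx R).
Implicit Types (p q : {poly C}) (r B : R).

(* The weighted l^1 norm of [p] at radius [r] is at most [B]. *)
Definition poly_bounded r p B := exists2 P : {poly R},
  (forall k, cmod p`_k <= P`_k) & P.[r] <= B.

Lemma horner_ge0_coef (P : {poly R}) r : 0 <= r -> (forall k, 0 <= P`_k) ->
  0 <= P.[r].
Proof.
move=> r0 P0; rewrite horner_coef; apply: sumr_ge0 => k _.
by rewrite mulr_ge0 ?exprn_ge0.
Qed.

Lemma poly_boundedW r p B B' : B <= B' -> poly_bounded r p B ->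
  poly_bounded r p B'.
Proof. by move=> BB [P pP PB]; exists P => //; exact: le_trans BB. Qed.

Lemma poly_bounded_radius r s p B : 0 <= s -> s <= r -> poly_bounded r p B ->
  poly_bounded s p B.
Proof.
move=> s0 sr [P pP PB]; exists P => //; apply: le_trans PB.
rewrite !horner_coef; apply: ler_sum => k _; rewrite ler_wpM2l //.
  exact: le_trans (cmod_ge0 _) (pP k).
by rewrite lerXn2r // nnegrE // (le_trans s0).
Qed.

Lemma poly_boundedC r (c : C) : poly_bounded r c%:P (cmod c).
Proof.
exists (cmod c)%:P; last by rewrite hornerC.
by move=> [|k]; rewrite !coefC //= cmod0.
Qed.

Lemma poly_boundedX r : poly_bounded r 'X r.
Proof.
exists 'X; last by rewrite hornerX.
by move=> k; rewrite !coefX; case: eqP; rewrite ?cmod1 ?cmod0.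
Qed.

Lemma poly_boundedD r p q B B' : poly_bounded r p B -> poly_bounded r q B' ->
  poly_bounded r (p + q) (B + B').
Proof.
move=> [P pP PB] [Q qQ QB]; exists (P + Q); last by rewrite hornerD lerD.
by move=> k; rewrite !coefD (le_trans (cmodD _ _)) // lerD.
Qed.

Lemma poly_boundedN r p B : poly_bounded r p B -> poly_bounded r (- p) B.
Proof. by move=> [P pP PB]; exists P => // k; rewrite coefN cmodN. Qed.

Lemma poly_boundedM r p q B B' : 0 <= r -> poly_bounded r p B ->
  poly_bounded r q B' -> poly_bounded r (p * q) (B * B').
Proof.
move=> r0 [P pP PB] [Q qQ QB]; exists (P * Q); last first.
  rewrite hornerM ler_pM // horner_ge0_coef // => k.
    exact: le_trans (cmod_ge0 _) (pP k).
  exact: le_trans (cmod_ge0 _) (qQ k).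
move=> k; rewrite !coefM (le_trans (cmod_sum _ _ _)) //.
by apply: ler_sum => i _; rewrite cmodM ler_pM ?cmod_ge0.
Qed.

Lemma poly_boundedZ r (c : C) p B : 0 <= r -> poly_bounded r p B ->
  poly_bounded r (c *: p) (cmod c * B).
Proof.
by move=> r0 pB; rewrite -mul_polyC; apply: poly_boundedM => //; exact: poly_boundedC.
Qed.

Lemma poly_boundedXn r p B n : 0 <= r -> poly_bounded r p B ->
  poly_bounded r (p ^+ n) (B ^+ n).
Proof.
move=> r0 pB; elim: n => [|n IH].
  by rewrite !expr0 -[X in poly_bounded _ _ X](@cmod1 R); exact: poly_boundedC.
by rewrite !exprS; apply: poly_boundedM.
Qed.

Lemma poly_bounded_sum r n (F : 'I_n -> {poly C}) (G : 'I_n -> R) :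
  (forall i, poly_bounded r (F i) (G i)) ->
  poly_bounded r (\sum_(i < n) F i) (\sum_(i < n) G i).
Proof.
move=> FG; elim/big_ind2: _ => [|p B q B' |i _]; last exact: FG.
  by rewrite -[X in poly_bounded _ _ X](@cmod0 R); exact: poly_boundedC.
exact: poly_boundedD.
Qed.

Lemma poly_bounded_take r p B n : 0 <= r -> poly_bounded r p B ->
  poly_bounded r (take_poly n p) B.
Proof.
move=> r0 [P pP PB]; exists P => // k; rewrite coef_take_poly.
case: ifP => // _; rewrite cmod0; exact: le_trans (cmod_ge0 _) (pP k).
Qed.

Lemma poly_bounded_coef r p B k : 0 <= r -> poly_bounded r p B ->
  cmod p`_k * r ^+ k <= B.
Proof.
move=> r0 [P pP PB]; apply: le_trans PB.
have P0 j : 0 <= P`_j by exact: le_trans (cmod_ge0 _) (pP j).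
rewrite (@horner_coef_wide _ (maxn (size P) k.+1)) ?leq_maxl //.
rewrite (bigD1 (Ordinal (leq_maxr (size P) k.+1))) //=.
rewrite (le_trans (ler_wpM2r _ (pP k))) ?exprn_ge0 // lerDl.
by apply: sumr_ge0 => j _; rewrite mulr_ge0 ?exprn_ge0.
Qed.

Lemma dvdXnP n p : reflect (forall k, (k < n)%N -> p`_k = 0) ('X^n %| p).
Proof.
apply: (iffP idP) => [/dvdpP [q ->] k kn|H]; first by rewrite coefMXn kn.
rewrite -(poly_take_drop n p) dvdp_add ?dvdp_mull //.
suff -> : take_poly n p = 0 by exact: dvdp0.
by apply/polyP => k; rewrite coef_take_poly coef0; case: ifP => // /H.
Qed.

Lemma dvd_take n p : 'X^n %| p - take_poly n p.
Proof. by apply/dvdXnP => k kn; rewrite coefB coef_take_poly kn subrr. Qed.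

(** A Schwarz-type estimate: only powers of index at least [n] occur, and each of them gains the
    factor (|s| / r)^n when the radius shrinks from r to |s|. *)
Lemma poly_bounded_dvd r p B n (s : C) : 0 < r -> cmod s <= r ->
  poly_bounded r p B -> 'X^n %| p -> cmod p.[s] <= B * (cmod s / r) ^+ n.
Proof.
move=> r0 sr [P pP PB] /dvdXnP pn.
have P0 j : 0 <= P`_j by exact: le_trans (cmod_ge0 _) (pP j).
set t := cmod s / r.
have t0 : 0 <= t by rewrite divr_ge0 ?cmod_ge0 // ltW.
have t1 : t <= 1 by rewrite ler_pdivrMr // mul1r.
have sE : cmod s = r * t by rewrite /t mulrC divfK // gt_eqF.
apply: le_trans (ler_wpM2r _ PB); last by rewrite exprn_ge0.
rewrite (@horner_coef_wide _ (maxn (size p) (size P))) ?leq_maxl //.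
rewrite (@horner_coef_wide _ (maxn (size p) (size P))) ?leq_maxr // mulr_suml.
apply: le_trans (cmod_sum _ _ _) _; apply: ler_sum => k _.
rewrite cmodM cmodX sE exprMn -[leRHS]mulrA.
have [kn|nk] := ltnP k n.
  by rewrite pn // cmod0 mul0r !mulr_ge0 ?exprn_ge0 // ltW.
apply: ler_pM => //; first exact: cmod_ge0.
  by rewrite mulr_ge0 ?exprn_ge0 // ltW.
apply: ler_wpM2l; first by rewrite exprn_ge0 // ltW.
by apply: ler_wiXn2l.
Qed.

Lemma poly_bounded_horner r p B (s : C) : 0 < r -> cmod s <= r ->
  poly_bounded r p B -> cmod p.[s] <= B.
Proof.
move=> r0 sr pB; have := @poly_bounded_dvd r p B 0 s r0 sr pB.
by rewrite expr0 mulr1; apply; exact: dvd1p.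
Qed.

Lemma poly_bounded_ge0 r p B : 0 <= r -> poly_bounded r p B -> 0 <= B.
Proof.
move=> r0 pB; have := poly_bounded_coef 0 r0 pB.
by apply: le_trans; rewrite mulr1 cmod_ge0.
Qed.

(* The polynomials [Q n] are truncations of one formal power series. *)
Definition stabilizing (Q : nat -> {poly C}) :=
  forall n, 'X^n %| Q n.+1 - Q n.

Lemma stabilizing_coef Q n k : stabilizing Q -> (k < n)%N ->
  (Q n)`_k = (Q k.+1)`_k.
Proof.
move=> HQ; elim: n => // n IH; rewrite ltnS leq_eqVlt => /predU1P[->//|kn].
rewrite -IH //; apply/eqP; rewrite -subr_eq0 -coefB.
by have /dvdXnP -> := HQ n.
Qed.

(** Below degree [n] the polynomial [Q n] is a partial sum of the limit series, whose tail is at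
    most 2 B (|s| / r)^n. The rest of [Q n] is divisible by ['X^n] and bounded by 2 B at radius [r],
    so it is equally small at [s]. *)
Lemma stabilizing_cvg Q r B : 0 < r -> stabilizing Q ->
  (forall n, poly_bounded r (Q n) B) ->
  let a k := (Q k.+1)`_k in
  geo_bounded a B r /\ forall s, 2 * cmod s <= r ->
    (fun n => (Q n).[s]) @ \oo --> psum a s.
Proof.
move=> r0 HQ QB a; have Ha : geo_bounded a B r.
  by split=> // k; apply: poly_bounded_coef; [exact: ltW | exact: QB].
split=> // s sr; have s0 := cmod_ge0 s; have [q0 q1] := psum_ratio r0 sr.
apply: (@cvgn_geometric_bound _ _ _ (4 * B) (cmod s / r)).
  by apply/andP; split; lra.
move=> n; apply: le_trans (cmod_triangle _ (take_poly n (Q n)).[s] _) _.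
have -> : (take_poly n (Q n)).[s] = series (fun k => a k * s ^+ k) n.
  rewrite (@horner_coef_wide _ n) ?size_take_poly // /series /= big_mkord.
  apply: eq_bigr => k _; rewrite coef_take_poly ltn_ord.
  by rewrite (stabilizing_coef HQ).
have h1 := psum_tail n Ha sr; rewrite cmodB in h1.
have h2 : cmod ((Q n).[s] - series (fun k => a k * s ^+ k) n) <=
   (B + B) * (cmod s / r) ^+ n.
  have -> : series (fun k => a k * s ^+ k) n = (take_poly n (Q n)).[s].
    rewrite (@horner_coef_wide _ n) ?size_take_poly // /series /= big_mkord.
    apply: eq_bigr => k _; rewrite coef_take_poly ltn_ord.
    by rewrite (stabilizing_coef HQ).
  rewrite -hornerN -hornerD; apply: poly_bounded_dvd => //; [lra| |exact: dvd_take].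
  apply: poly_boundedD; first exact: QB.
  by apply: poly_boundedN; apply: poly_bounded_take; [exact: ltW | exact: QB].
by apply: le_trans (lerD h2 h1) _; rewrite -mulrDl; apply: ler_wpM2r;
  rewrite ?exprn_ge0 //; lra.
Qed.

(** Second-order Taylor at [x]: since |y - x| is at most r / 2, the quadratic error contributes 16 K
    / r, and the derivative contributes 4 K / r. *)
Lemma psum_lipschitz (a : nat -> C) K r (x y : C) : geo_bounded a K r ->
  4 * cmod x <= r -> 4 * cmod y <= r ->
  cmod (psum a y - psum a x) <= 20 * K / r * cmod (y - x).
Proof.
move=> Ha xr yr; have r0 := proj1 Ha; have K0 := geo_bounded_ge0 Ha.
have := @psum_taylor2 _ a K r x (y - x) Ha xr; rewrite addrC subrK => /(_ yr) h.
have hd : cmod (psum (dcoef a) x) <= 2 * (K / r * 2).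
  by apply: psum_le (geo_bounded_dcoef Ha) _; lra.
have hyx : cmod (y - x) <= r / 2.
  by have := cmodD y (- x); rewrite cmodN; lra.
set E := psum a y - psum a x in h *.
have -> : E = (E - (y - x) * psum (dcoef a) x) + (y - x) * psum (dcoef a) x.
  by rewrite subrK.
apply: le_trans (cmodD _ _) _; rewrite [cmod (_ * psum _ _)]cmodM.
have c0 := cmod_ge0 (y - x).
have h1 : 32 * K / r ^+ 2 * cmod (y - x) ^+ 2 <= 16 * K / r * cmod (y - x).
  have -> : 32 * K / r ^+ 2 * cmod (y - x) ^+ 2 =
    (32 * K / r ^+ 2 * cmod (y - x)) * cmod (y - x) by ring.
  apply: ler_wpM2r => //.
  have -> : 16 * K / r = 32 * K / r ^+ 2 * (r / 2) by field; rewrite gt_eqF.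
  by apply: ler_wpM2l => //; apply: divr_ge0; [rewrite mulr_ge0 | rewrite exprn_ge0 // ltW].
have h2 : cmod (y - x) * cmod (psum (dcoef a) x) <= 4 * K / r * cmod (y - x).
  rewrite mulrC; apply: ler_wpM2r => //; apply: le_trans hd _.
  by have -> : 4 * K / r = 2 * (K / r * 2) by ring.
apply: le_trans (lerD (le_trans h h1) h2) _.
rewrite -mulrDl; apply: ler_wpM2r => //; rewrite -mulrDl.
by apply: ler_wpM2r; [rewrite invr_ge0 ltW | lra].
Qed.

(** Polynomial counterpart of f(s p(s)), with [f] cut after degree [n]. The factor ['X] is what
    gains an order: changing [p] at order n changes the result at order n + 1. *)
Definition poly_comp (f : nat -> C) n p : {poly C} :=
  \sum_(k < n.+1) f k *: ('X * p) ^+ k.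

Lemma sum_geometric_half (q : R) n : 0 <= q -> 2 * q <= 1 ->
  \sum_(k < n) q ^+ k <= 2.
Proof.
move=> q0 q1; suff : \sum_(k < n) q ^+ k <= 2 * (1 - q ^+ n).
  by move/le_trans; apply; have := exprn_ge0 n q0; lra.
elim: n => [|n IH]; first by rewrite big_ord0 expr0 subrr mulr0.
rewrite big_ord_recr /= exprS; have := exprn_ge0 n q0; nra.
Qed.

Lemma poly_comp_bounded f K r0 n p r B : 0 <= r -> geo_bounded f K r0 ->
  poly_bounded r p B -> 2 * (r * B) <= r0 ->
  poly_bounded r (poly_comp f n p) (2 * K).
Proof.
move=> r_ge0 Hf pB rB; have r00 := proj1 Hf; have K0 := geo_bounded_ge0 Hf.
have B0 := poly_bounded_ge0 r_ge0 pB.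
set q := r * B / r0.
have q0 : 0 <= q by rewrite /q divr_ge0 ?mulr_ge0 // ltW.
have q1 : 2 * q <= 1 by rewrite /q mulrA ler_pdivrMr // mul1r.
have : poly_bounded r (poly_comp f n p) (\sum_(k < n.+1) K * q ^+ k).
  apply: poly_bounded_sum => k.
  have : poly_bounded r (f k *: ('X * p) ^+ k) (cmod (f k) * (r * B) ^+ k).
    apply: poly_boundedZ => //; apply: poly_boundedXn => //.
    by apply: poly_boundedM => //; exact: poly_boundedX.
  apply: poly_boundedW; rewrite /q expr_div_n mulrA ler_pdivlMr ?exprn_gt0 //.
  rewrite mulrAC; apply: ler_wpM2r; last exact: (proj2 Hf).
  by rewrite exprn_ge0 // mulr_ge0.
apply: poly_boundedW; rewrite -mulr_sumr mulrC ler_wpM2r //.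
exact: sum_geometric_half.
Qed.

Lemma poly_comp_recl f n p :
  poly_comp f n.+1 p = (f 0%N)%:P + 'X * p * poly_comp (fun k => f k.+1) n p.
Proof.
rewrite /poly_comp big_ord_recl expr0 alg_polyC mulr_sumr; congr (_ + _).
by apply: eq_bigr => k _; rewrite -scalerAr -exprS.
Qed.

Lemma poly_comp0 f p : poly_comp f 0 p = (f 0%N)%:P.
Proof. by rewrite /poly_comp big_ord_recl big_ord0 expr0 addr0 alg_polyC. Qed.

(** The factor [r] is the point of the bound: shrinking the radius makes the nonconstant part
    arbitrarily small, which closes the estimate of [branch_radius]. *)
Lemma poly_comp_sub0_bounded f K r0 n p r B : 0 <= r -> geo_bounded f K r0 ->
  poly_bounded r p B -> 2 * (r * B) <= r0 ->
  poly_bounded r (poly_comp f n p - (f 0%N)%:P) (r * B * (2 * (K / r0))).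
Proof.
move=> r_ge0 Hf pB rB; have B0 := poly_bounded_ge0 r_ge0 pB.
have K0 := geo_bounded_ge0 (geo_bounded_shift Hf).
case: n => [|n].
  rewrite poly_comp0 subrr; apply: (@poly_boundedW _ _ (cmod (0 : C))).
    by rewrite cmod0; apply: mulr_ge0; apply: mulr_ge0.
  exact: poly_boundedC.
rewrite poly_comp_recl addrAC subrr add0r; apply: poly_boundedM => //.
  by apply: poly_boundedM => //; exact: poly_boundedX.
exact: poly_comp_bounded (geo_bounded_shift Hf) pB rB.
Qed.

Lemma dvdp_subX (p q d : {poly C}) n : d %| p - q -> d %| p ^+ n - q ^+ n.
Proof. by move=> dpq; rewrite subrXX dvdp_mulr. Qed.

(** The additional last term carries ['X^n.+1]; every other difference is divisible by ['X] times
    [q - p]. *)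
Lemma poly_comp_stabilizing f p q n : 'X^n %| q - p ->
  'X^(n.+1) %| poly_comp f n.+1 q - poly_comp f n p.
Proof.
move=> pq; rewrite [poly_comp f n.+1 q]/poly_comp big_ord_recr /= addrAC.
apply: dvdp_add; last first.
  by rewrite -mul_polyC exprMn dvdp_mull // dvdp_mulr.
rewrite /poly_comp -sumrB; elim/big_ind: _ => [|x y hx hy|k _].
- exact: dvdp0.
- exact: dvdp_add.
rewrite -scalerBr -mul_polyC dvdp_mull // dvdp_subX // -mulrBr exprS.
by rewrite dvdp_mul.
Qed.

(** The error splits in two: cutting [f] costs a tail that decays uniformly in the argument, and
    replacing the value of [V n] by its limit is controlled by the Lipschitz bound on [psum f]. *)
Lemma poly_comp_cvg f K r0 (V : nat -> {poly C}) r B (s v : C) : 0 < r ->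
  geo_bounded f K r0 -> (forall n, poly_bounded r (V n) B) ->
  4 * (r * B) <= r0 -> cmod s <= r -> (fun n => (V n).[s]) @ \oo --> v ->
  (fun n => (poly_comp f n (V n)).[s]) @ \oo --> psum f (s * v).
Proof.
move=> r_gt0 Hf VB rB sr Vv; have r00 := proj1 Hf; have K0 := geo_bounded_ge0 Hf.
have B0 : 0 <= B by exact: poly_bounded_ge0 (ltW r_gt0) (VB 0%N).
have VsB n : cmod (V n).[s] <= B by exact: poly_bounded_horner (VB n).
have vB : cmod v <= B.
  rewrite -[v]subr0; apply: (cvgn_cmod_le Vv); exists 0%N => n _.
  by rewrite subr0.
have bd x : cmod x <= B -> 4 * cmod (s * x) <= r0.
  move=> xB; apply: le_trans rB; rewrite ler_wpM2l // cmodM.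
  by apply: ler_pM => //; exact: cmod_ge0.
have -> : (fun n => (poly_comp f n (V n)).[s]) = (fun n =>
    ((poly_comp f n (V n)).[s] - psum f (s * (V n).[s])) +
    psum f (s * (V n).[s])).
  by apply/funext => n; rewrite subrK.
rewrite -[psum f _ in X in _ --> X]add0r; apply: cvgD.
  have q01 : 0 <= (2^-1 : R) < 1 by apply/andP; split; lra.
  apply: (@cvgn_geometric_bound _ _ _ (2 * K) 2^-1 q01) => n.
  rewrite subr0 cmodB.
  have -> : (poly_comp f n (V n)).[s] =
      series (fun k => f k * (s * (V n).[s]) ^+ k) n.+1.
    rewrite /poly_comp horner_sum /series /= big_mkord; apply: eq_bigr => k _.
    by rewrite hornerZ horner_exp hornerM hornerX.
  have b4 := bd _ (VsB n); have c0 := cmod_ge0 (s * (V n).[s]).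
  have b2 : 2 * cmod (s * (V n).[s]) <= r0 by lra.
  apply: le_trans (psum_tail n.+1 Hf b2) _.
  rewrite ler_wpM2l ?mulr_ge0 //.
  have [q0 q1] := psum_ratio r00 b2; set q := _ / _ in q0 q1 *.
  apply: (@le_trans _ _ (q ^+ n)); first by apply: ler_wiXn2l => //; lra.
  by rewrite lerXn2r // ?nnegrE //; lra.
apply/cvgn_cmodP => e e0; move/cvgn_cmodP: Vv.
have D0 : 0 < 20 * K / r0 * cmod s + 1.
  by rewrite ltr_wpDl // mulr_ge0 ?cmod_ge0 // divr_ge0 ?mulr_ge0 // ltW.
move=> /(_ (e / (20 * K / r0 * cmod s + 1))).
rewrite divr_gt0 // => /(_ isT) [N HN]; exists N => n Nn.
apply: le_lt_trans (psum_lipschitz Hf (bd _ vB) (bd _ (VsB n))) _.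
rewrite -mulrBr cmodM mulrA; have := HN n Nn.
rewrite ltr_pdivlMr //; apply: le_lt_trans; rewrite mulrC ler_wpM2l ?cmod_ge0 //.
by rewrite lerDl.
Qed.

End Majorants.

(** * The series [v]: formal construction, bounds and the equation it satisfies *)

Section SquareRootBranch.
Variable R : realType.
Local Notation C := (Cplx R).
Variables (g : nat -> C) (w : C).
Hypothesis gw : g 0%N * w ^+ 2 = 1.
Implicit Types (p q : {poly C}).

(* Solving [v ^+ 2 * g (s v) = 1] with [v = w + p] amounts to solving
   [p = branch_step p], whose right-hand side raises the order of [p]. *)
Definition branch_step n p : {poly C} :=
  - (2 * w * g 0%N)^-1 *: (g 0%N *: p ^+ 2 +
     (w%:P + p) ^+ 2 * (poly_comp g n (w%:P + p) - (g 0%N)%:P)).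

(** The step isolates the linear term 2 w g_0 p of the equation. As it settles one more coefficient
    each time, keeping degrees below [n] leaves exactly the truncation of the formal solution. *)
Fixpoint branch_seq n : {poly C} :=
  if n is m.+1 then take_poly n (branch_step m (branch_seq m)) else 0.

Lemma dvdX_poly_comp f n p : 'X %| poly_comp f n p - (f 0%N)%:P.
Proof.
case: n => [|n]; first by rewrite poly_comp0 subrr dvdp0.
by rewrite poly_comp_recl addrAC subrr add0r !dvdp_mulr.
Qed.

Lemma dvdX_branch_step n p : 'X %| p -> 'X %| branch_step n p.
Proof.
move=> Xp; rewrite /branch_step -mul_polyC dvdp_mull // dvdp_add //.
  by rewrite -mul_polyC dvdp_mull // expr2 dvdp_mulr.
by rewrite dvdp_mull // dvdX_poly_comp.
Qed.

(** One order is gained in three places: q^2 - p^2 has the factor q + p, divisible by ['X]; the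
    composite gains one by [poly_comp_stabilizing]; the difference of the squares of w + q and w + p
    is multiplied by [Gp], again divisible by ['X]. *)
Lemma branch_step_contraction n p q : 'X %| p -> 'X %| q -> 'X^n %| q - p ->
  'X^(n.+1) %| branch_step n.+1 q - branch_step n p.
Proof.
move=> Xp Xq pq; rewrite /branch_step -scalerBr -mul_polyC dvdp_mull //.
have pq' : 'X^n %| (w%:P + q) - (w%:P + p).
  by rewrite opprD addrACA subrr add0r.
set Gq := poly_comp g n.+1 _ - _; set Gp := poly_comp g n _ - _.
have -> : g 0%N *: q ^+ 2 + (w%:P + q) ^+ 2 * Gq -
   (g 0%N *: p ^+ 2 + (w%:P + p) ^+ 2 * Gp) =
   (g 0%N)%:P * ((q - p) * (q + p)) +
   ((w%:P + q) ^+ 2 * (Gq - Gp) +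
    ((w%:P + q) ^+ 2 - (w%:P + p) ^+ 2) * Gp).
  by rewrite -!mul_polyC; ring.
apply: dvdp_add; first by rewrite dvdp_mull // exprSr dvdp_mul // dvdp_add.
apply: dvdp_add.
  rewrite dvdp_mull // /Gq /Gp opprB addrA subrK.
  exact: poly_comp_stabilizing.
by rewrite exprSr dvdp_mul // ?dvdp_subX // dvdX_poly_comp.
Qed.

Lemma dvdX_branch_seq n : 'X %| branch_seq n.
Proof.
elim: n => [|n IH] /=; first exact: dvdp0.
have := dvdX_branch_step n IH; rewrite -['X]expr1 => /dvdXnP H.
by apply/dvdXnP => k k1; rewrite coef_take_poly H // if_same.
Qed.

Lemma branch_seq_stabilizing : stabilizing branch_seq.
Proof.
move=> n; elim: n => [|n IH]; first by rewrite expr0 dvd1p.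
have H := branch_step_contraction (dvdX_branch_seq n) (dvdX_branch_seq n.+1) IH.
have -> : branch_seq n.+2 - branch_seq n.+1 =
  - (branch_step n.+1 (branch_seq n.+1) - branch_seq n.+2) +
  ((branch_step n.+1 (branch_seq n.+1) - branch_step n (branch_seq n)) +
   (branch_step n (branch_seq n) - branch_seq n.+1)) by ring.
apply: dvdp_add; last by apply: dvdp_add => //; exact: dvd_take.
rewrite dvdpNr; apply: dvdp_trans (dvd_take n.+2 _).
by rewrite dvdp_exp2l.
Qed.

(** The bound [eta] is chosen before the radius: C1 eta <= 1/2 makes the quadratic term cost at most
    eta / 2. The remaining term is at most r D with [D] independent of [r], so a small [r] makes it
    cost at most eta / 2 as well, and the bound [eta] reproduces itself along the iteration. *)
Lemma branch_radius K r0 : geo_bounded g K r0 ->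
  exists r eta : R, [/\ 0 < r, 0 < eta, 4 * (r * (cmod w + eta)) <= r0 &
    forall n, poly_bounded r (branch_seq n) eta].
Proof.
move=> Hg; have r00 := proj1 Hg; have K0 := geo_bounded_ge0 Hg.
set c := cmod (- (2 * w * g 0%N)^-1).
have c0 : 0 <= c by exact: cmod_ge0.
have g0 := cmod_ge0 (g 0%N); have w0 := cmod_ge0 w.
set C1 := c * cmod (g 0%N); have C10 : 0 <= C1 by rewrite mulr_ge0.
pose eta := (2 * (C1 + 1))^-1.
have eta0 : 0 < eta by rewrite invr_gt0; lra.
have C1eta : C1 * eta <= 2^-1.
  rewrite /eta ler_pdivrMr; last by lra.
  by lra.
pose B := cmod w + eta; have B0 : 0 < B by rewrite /B; lra.
pose D := c * B ^+ 2 * (B * (2 * (K / r0))).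
have D0 : 0 <= D.
  have Kr : 0 <= K / r0 by rewrite divr_ge0 // ltW.
  have B0' := ltW B0; apply: mulr_ge0; apply: mulr_ge0 => //.
    exact: exprn_ge0.
  exact: mulr_ge0.
pose r := Num.min (eta / (2 * (D + 1))) (r0 / (4 * B)).
have r_gt0 : 0 < r by rewrite lt_min !divr_gt0 //; lra.
have rD : r * D <= eta / 2.
  have rle : r <= eta / (2 * (D + 1)) by rewrite ge_min lexx.
  rewrite ler_pdivlMr in rle; nra.
have rB : 4 * (r * B) <= r0.
  have rle : r <= r0 / (4 * B) by rewrite ge_min lexx orbT.
  rewrite ler_pdivlMr in rle; nra.
exists r, eta; split => //; have r_ge0 := ltW r_gt0.
have rB0 : 0 <= r * B by rewrite mulr_ge0 // ltW.
elim=> [|n IH] /=.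
  apply: (@poly_boundedW _ _ _ (cmod (0 : C))); first by rewrite cmod0 ltW.
  exact: poly_boundedC.
apply: poly_bounded_take => //; rewrite /branch_step.
have VB : poly_bounded r (w%:P + branch_seq n) B.
  by apply: poly_boundedD => //; exact: poly_boundedC.
have rB2 : 2 * (r * B) <= r0 by lra.
have H : poly_bounded r (branch_step n (branch_seq n))
  (c * (cmod (g 0%N) * eta ^+ 2 + B ^+ 2 * (r * B * (2 * (K / r0))))).
  apply: poly_boundedZ => //; apply: poly_boundedD.
    by apply: poly_boundedZ => //; exact: poly_boundedXn.
  apply: poly_boundedM => //; first exact: poly_boundedXn.
  exact: poly_comp_sub0_bounded.
apply: poly_boundedW H.
have -> : c * (cmod (g 0%N) * eta ^+ 2 + B ^+ 2 * (r * B * (2 * (K / r0)))) =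
  (C1 * eta) * eta + r * D by rewrite /C1 /D; ring.
nra.
Qed.

Lemma branch_nz : w != 0 /\ g 0%N != 0.
Proof.
split; apply/eqP => H; have := gw; rewrite H ?expr0n ?mulr0 ?mul0r => /eqP;
  by rewrite eq_sym oner_eq0.
Qed.

Lemma branch_seq1 : branch_seq 1 = 0.
Proof.
apply/polyP => -[|k]; rewrite coef0; last by rewrite /= coef_take_poly.
by have := dvdX_branch_seq 1; rewrite -['X]expr1 => /dvdXnP ->.
Qed.

(** At order one the equation says 2 w g_0 v_1 + w^3 g_1 = 0, and 1 / g_0 = w^2. This coefficient is
    the source of the third derivative of [rho] in beta. *)
Lemma branch_seq2_coef1 : (branch_seq 2)`_1 = - (w ^+ 4 * g 1%N / 2).
Proof.
have [w0 g0] := branch_nz.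
rewrite [branch_seq 2]/(take_poly 2 (branch_step 1 (branch_seq 1))) branch_seq1.
rewrite coef_take_poly /= /branch_step expr0n /= scaler0 add0r addr0.
rewrite poly_comp_recl addrAC subrr add0r poly_comp0.
have -> : 'X * w%:P * (g 1%N)%:P = (w * g 1%N) *: 'X.
  by rewrite -mul_polyC polyCM; ring.
rewrite -polyC_exp coefZ coefCM coefZ coefX /= mulr1.
have -> : w ^+ 4 = w ^+ 2 / g 0%N by rewrite -[w ^+ 2 / _]mulr1 -gw; field.
by field; rewrite g0 w0.
Qed.

(** The approximating polynomials are returned together with their limit series because [lambda]
    still has to be composed with them. *)
Lemma square_root_branch K r0 : geo_bounded g K r0 ->
  exists (V : nat -> {poly C}) (a : nat -> C) (r B : R),
  [/\ stabilizing V, forall n, poly_bounded r (V n) B, geo_bounded a B r,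
      [/\ a 0%N = w, a 1%N = - (w ^+ 4 * g 1%N / 2),
       4 * (r * B) <= r0 & forall n k, (k < n)%N -> (V n)`_k = a k] &
      forall s, 2 * cmod s <= r ->
       (fun n => (V n).[s]) @ \oo --> psum a s /\
       psum a s ^+ 2 * psum g (s * psum a s) = 1].
Proof.
move=> Hg; have [r [eta [r0' eta0 rB HP]]] := branch_radius Hg.
pose V n := w%:P + branch_seq n; pose B := cmod w + eta.
have VB n : poly_bounded r (V n) B.
  by apply: poly_boundedD => //; exact: poly_boundedC.
have HV : stabilizing V.
  move=> n; rewrite /V opprD addrACA subrr add0r; exact: branch_seq_stabilizing.
have [Ha Vcvg] := stabilizing_cvg r0' HV VB.
set a := fun k => (V k.+1)`_k in Ha Vcvg.
exists V, a, r, B; split => //.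
  split => //.
  - rewrite /a /V coefD coefC /=; have := dvdX_branch_seq 1.
    by rewrite -['X]expr1 => /dvdXnP -> //; rewrite addr0.
  - by rewrite /a /V coefD coefC branch_seq2_coef1 add0r.
  - by move=> n k kn; apply: stabilizing_coef.
move=> s sr; split; first exact: Vcvg.
have s0 := cmod_ge0 s.
have sr1 : cmod s <= r by lra.
have cV := Vcvg s sr.
have cP : (fun n => (branch_seq n).[s]) @ \oo --> psum a s - w.
  have -> : (fun n => (branch_seq n).[s]) = (fun n => (V n).[s] - w).
    by apply/funext => n; rewrite /V hornerD hornerC addrAC subrr add0r.
  by apply: cvgB; [exact: cV | exact: cvg_cst].
have cG := poly_comp_cvg r0' Hg VB rB sr1 cV.
set v := psum a s in cV cP cG *.
set c := - (2 * w * g 0%N)^-1.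
(* First of two limits of the same sequence: the right-hand side of the fixed-point equation at [v],
   by continuity of each operation. *)
have cT : (fun n => (branch_step n (branch_seq n)).[s]) @ \oo -->
    c * (g 0%N * (v - w) ^+ 2 + v ^+ 2 * (psum g (s * v) - g 0%N)).
  have -> : (fun n => (branch_step n (branch_seq n)).[s]) = (fun n =>
    c * (g 0%N * ((branch_seq n).[s] * (branch_seq n).[s]) +
     ((V n).[s] * (V n).[s]) * ((poly_comp g n (V n)).[s] - g 0%N))).
    apply/funext => n; rewrite /branch_step -/c !(hornerE, horner_exp) /=.
    by rewrite !expr2.
  rewrite !expr2; apply: cvgM; first exact: cvg_cst.
  apply: cvgD; apply: cvgM.
  - exact: cvg_cst.
  - by apply: cvgM; exact: cP.
  - by apply: cvgM; exact: cV.
  - by apply: cvgB; [exact: cG | exact: cvg_cst].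
(* Second limit: the sequence differs from the next iterate by a truncation error divisible by
   ['X^n.+1] and uniformly bounded at radius [r], hence vanishing at [s]. Equating both limits gives
   the fixed-point equation. *)
have cT' : (fun n => (branch_step n (branch_seq n)).[s]) @ \oo --> v - w.
  have r_ge0 := ltW r0'.
  have [q0 q1] := psum_ratio r0' sr.
  have stepB n : poly_bounded r (branch_step n (branch_seq n)
      - branch_seq n.+1) (cmod c * (cmod (g 0%N) * eta ^+ 2 +
       B ^+ 2 * (2 * K + cmod (g 0%N))) + eta).
    apply: poly_boundedD; last by apply: poly_boundedN.
    apply: poly_boundedZ => //; apply: poly_boundedD.
      by apply: poly_boundedZ => //; exact: poly_boundedXn.
    apply: poly_boundedM => //; first by apply: poly_boundedXn => //; exact: VB.
    apply: poly_boundedD; last by apply: poly_boundedN; exact: poly_boundedC.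
    apply: (poly_comp_bounded _ _ Hg (VB n)) => //.
    have : 0 <= r * B by apply: mulr_ge0 => //; exact: poly_bounded_ge0 (VB 0%N).
    by rewrite -/B in rB; lra.
  have c1 : (fun n => (branch_step n (branch_seq n)).[s] -
       (branch_seq n.+1).[s]) @ \oo --> (0 : C).
    have q01 : 0 <= cmod s / r < 1 by apply/andP; split; lra.
    apply: (cvgn_geometric_bound q01) => n.
    rewrite subr0 -hornerN -hornerD.
    apply: le_trans (poly_bounded_dvd r0' sr1 (stepB n) (dvd_take _ _)) _.
    apply: ler_wpM2l; first exact: poly_bounded_ge0 (stepB n).
    by apply: ler_wiXn2l => //; lra.
  have -> : (fun n => (branch_step n (branch_seq n)).[s]) =
    (fun n => ((branch_step n (branch_seq n)).[s] - (branch_seq n.+1).[s]) +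
       (branch_seq n.+1).[s]) by apply/funext => n; rewrite subrK.
  rewrite -[v - w]add0r; apply: cvgD; first exact: c1.
  by move: cP; rewrite -(cvg_shiftS (fun n => (branch_seq n).[s])).
have E := cvg_lim (@norm_hausdorff _ _) cT'.
rewrite (cvg_lim (@norm_hausdorff _ _) cT) in E.
have [w0 g0] := branch_nz.
have E2 : - (2 * w * g 0%N) * (c * (g 0%N * (v - w) ^+ 2 + v ^+ 2 *
    (psum g (s * v) - g 0%N))) = - (2 * w * g 0%N) * (v - w) by rewrite E.
have cc : - (2 * w * g 0%N) * c = 1.
  by rewrite /c mulrNN mulfV // !mulf_neq0 // pnatr_eq0.
rewrite mulrA cc mul1r in E2.
apply/eqP; rewrite -subr_eq0 -[X in _ - X]gw; apply/eqP.
transitivity (g 0%N * (v - w) ^+ 2 + v ^+ 2 * (psum g (s * v) - g 0%N) -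
  - (2 * w * g 0%N) * (v - w)); last by rewrite E2 subrr.
by ring.
Qed.

End SquareRootBranch.

(** * The branch through the critical point, and uniqueness of its two preimages *)

Section LocalBranch.
Variable R : realType.
Local Notation C := (Cplx R).
Implicit Types (a b c g l : nat -> C) (K r : R).

(** As [b 1] vanishes, g is the series of [rho] shifted twice. The series [c] of the branch is the
    stabilised limit of the polynomials [Q n], truncated composites of [lambda] with s v(s), on a
    radius [r'] small enough for the series of [lambda] to accept these arguments. *)
Lemma local_branch (rho lambda : C -> C) (mu : C) b l (w : C) :
  has_psum rho mu b -> has_psum lambda mu l -> b 1%N = 0 ->
  b 2%N * w ^+ 2 = 1 ->
  exists a c, [/\ exists K r, geo_bounded a K r, exists K r, geo_bounded c K r,
    a 0%N = w,
    [/\ c 0%N = l 0%N, c 1%N = l 1%N * w &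
        c 2%N = l 2%N * w ^+ 2 - l 1%N * (w ^+ 4 * b 3%N / 2)] &
    exists2 e : R, 0 < e & forall s, cmod s < e ->
     [/\ (s * psum a s) ^+ 2 * psum (fun k => b k.+2) (s * psum a s) = s ^+ 2,
         rho (mu + s * psum a s) = rho mu + s ^+ 2 &
         lambda (mu + s * psum a s) = psum c s]].
Proof.
move=> Hrho [Kl [rl [Hl lE]]] b1 bw; have rho0 := has_psum_at Hrho.
case: Hrho => Kb [rb [Hb bE]].
pose g k := b k.+2; have Hg := geo_bounded_shift (geo_bounded_shift Hb).
have gw : g 0%N * w ^+ 2 = 1 by [].
have [V [a [r [B [HV VB Ha [a0 a1 rB Va] Hs]]]]] := square_root_branch gw Hg.
have r_gt0 := proj1 Ha; have rl0 := proj1 Hl.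
have B0 : 0 <= B by exact: poly_bounded_ge0 (ltW r_gt0) (VB 0%N).
pose r' := Num.min r (rl / (4 * (B + 1))).
have r'0 : 0 < r' by rewrite lt_min r_gt0 divr_gt0 //; lra.
have r'r : r' <= r by rewrite ge_min lexx.
have r'B : 4 * (r' * B) <= rl.
  have rle : r' <= rl / (4 * (B + 1)) by rewrite ge_min lexx orbT.
  rewrite ler_pdivlMr in rle; nra.
have VB' n : poly_bounded r' (V n) B by apply: poly_bounded_radius (VB n); lra.
pose Q n := poly_comp l n (V n).
have HQ : stabilizing Q.
  move=> n; apply: dvdp_trans (poly_comp_stabilizing _ (HV n)).
  by rewrite dvdp_exp2l.
have QB n : poly_bounded r' (Q n) (2 * Kl).
  apply: (poly_comp_bounded _ _ Hl (VB' n)); first lra.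
  have : 0 <= r' * B by rewrite mulr_ge0 // ltW.
  by lra.
have [Hc Qcvg] := stabilizing_cvg r'0 HQ QB.
set c := fun k => (Q k.+1)`_k in Hc Qcvg.
(* Degrees 0, 1 and 2 are already final in [Q 3], a sum of four explicit terms. *)
have Hc' k : (k < 3)%N -> c k = (Q 3)`_k.
  by move=> k3; rewrite (stabilizing_coef HQ k3).
have Q3E : Q 3 = (l 0%N)%:P + (l 1%N)%:P * (V 3 * 'X) + (l 2%N)%:P * ((V 3) ^+ 2 * 'X^2)
   + (l 3%N)%:P * ((V 3)^+3 * 'X^3).
  rewrite /Q /poly_comp !big_ord_recl big_ord0 /= -!mul_polyC; ring.
exists a, c; split => //.
- by exists B, r.
- by exists (2 * Kl), r'.
- rewrite !Hc' // Q3E !coefD !coefCM !coefMX !coefMXn !coefC /= expr2 coefM.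
  rewrite big_ord1 subn0 -[nat_of_ord ord0]/0%N !Va // a0 a1 /g.
  by split; ring.
have rb0 := proj1 Hb.
pose e := Num.min (r' / 2) (rb / (4 * (B + 1))).
have e0 : 0 < e by rewrite lt_min !divr_gt0 //; lra.
exists e => // s; rewrite lt_min => /andP[s1 s2].
have s0 := cmod_ge0 s.
have sr' : cmod s <= r' by lra.
have s2r : 2 * cmod s <= r by lra.
have [Vs Eq] := Hs s s2r.
set v := psum a s in Vs Eq *.
have vB : cmod v <= B.
  rewrite -[v]subr0; apply: (cvgn_cmod_le Vs); exists 0%N => n _.
  rewrite subr0; apply: poly_bounded_horner (VB' n) => //.
have svB : cmod (s * v) <= cmod s * B by rewrite cmodM ler_wpM2l.
have sv_l : 2 * cmod (s * v) <= rl by nra.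
have sv_b : 2 * cmod (s * v) <= rb.
  by rewrite ltr_pdivlMr in s2; nra.
have E1 : (s * v) ^+ 2 * psum g (s * v) = s ^+ 2 by rewrite exprMn -mulrA Eq mulr1.
have muE : mu + s * v - mu = s * v by rewrite addrC addKr.
split; first exact: E1.
  rewrite bE muE; last exact: sv_b.
  rewrite rho0 (psum_shift Hb sv_b).
  rewrite (psum_shift (geo_bounded_shift Hb) sv_b) b1 add0r -E1 addrC /g; ring.
rewrite lE muE; last exact: sv_l.
(* The values of [Q n] at [s] tend to [psum l (s * v)] as composites and to [psum c s] as a
   stabilising sequence, so the two agree. *)
have cQ := poly_comp_cvg r'0 Hl VB' r'B sr' Vs.
have s2r' : 2 * cmod s <= r' by lra.
exact: cvgn_cmod_unique cQ (Qcvg s s2r').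
Qed.

Lemma psum_sub0_le a K r (s : C) : geo_bounded a K r -> 4 * cmod s <= r ->
  cmod (psum a s - a 0%N) <= 20 * K / r * cmod s.
Proof.
move=> Ha sr; have z0 : 4 * cmod (0 : C) <= r.
  by rewrite cmod0 mulr0 ltW // (proj1 Ha).
by have := psum_lipschitz Ha z0 sr; rewrite (psum_at0 Ha) subr0.
Qed.

(* Cancel [x - y] in [(x - y) * (x + y) * g x = y ^+ 2 * (g y - g x)], [g] being
   Lipschitz. *)
Lemma square_branch_dichotomy g K r (gam : R) (x y : C) : geo_bounded g K r ->
  4 * cmod x <= r -> 4 * cmod y <= r -> 0 < gam -> gam <= cmod (psum g x) ->
  x ^+ 2 * psum g x = y ^+ 2 * psum g y -> x != y ->
  cmod (x + y) <= 20 * K / r / gam * cmod y ^+ 2.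
Proof.
move=> Hg xr yr gam0 gx E xy; have K0 := geo_bounded_ge0 Hg.
have xy0 : 0 < cmod (x - y) by rewrite cmod_gt0 subr_eq0.
have E2 : (x - y) * ((x + y) * psum g x) = y ^+ 2 * (psum g y - psum g x).
  transitivity (x ^+ 2 * psum g x - y ^+ 2 * psum g x); first by ring.
  by rewrite E mulrBr.
have := congr1 (@cmod R) E2; rewrite !cmodM -[cmod y * _]expr2 => {}E2.
have lip := psum_lipschitz Hg xr yr; rewrite [cmod (y - x)]cmodB in lip.
have h : cmod (x + y) * cmod (psum g x) <= cmod y ^+ 2 * (20 * K / r).
  rewrite -(ler_pM2l xy0) E2.
  apply: le_trans (ler_wpM2l _ lip) _; first by rewrite exprn_ge0 ?cmod_ge0.
  by rewrite le_eqVlt; apply/orP; left; apply/eqP; ring.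
rewrite mulrAC ler_pdivlMr // [leRHS]mulrC; apply: le_trans h.
by rewrite ler_wpM2l ?cmod_ge0.
Qed.

Lemma cmod_sub_of_sums (t x y : C) (B : R) : cmod (t + x) <= B ->
  cmod (t + y) <= B -> cmod (x - y) <= B + B.
Proof.
move=> tx ty; have -> : x - y = (t + x) - (t + y) by ring.
by apply: le_trans (cmodD _ _) _; rewrite cmodN lerD.
Qed.

(** Here [p] and [m] stand for the values of [psum a] at s and - s, both close to w = a_0: the two
    known solutions then lie about 2 |s w| apart. *)
Lemma cmod_odd_part_lower (s p m w : C) : 2 * (cmod s * cmod w) <=
  cmod (s * p - (- s * m)) + cmod s * (cmod (p - w) + cmod (m - w)).
Proof.
rewrite -cmodM -(@cmod_natr R 2) -cmodM.
have -> : 2%:R * (s * w) =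
   (s * p - (- s * m)) - s * ((p - w) + (m - w)) by ring.
apply: le_trans (cmodD _ _) _; rewrite cmodN lerD2l cmodM.
by rewrite ler_wpM2l ?cmod_ge0 // cmodD.
Qed.

(* With [phi s = s * psum a s], a third solution [t] would be within [O(s ^+ 2)]
   of both [- phi s] and [- phi (- s)], whose distance is about [2 |s a_0|]. *)
Lemma square_branch_unique g a : (exists K r, geo_bounded g K r) ->
  (exists K r, geo_bounded a K r) -> g 0%N != 0 -> a 0%N != 0 ->
  (exists2 e : R, 0 < e & forall s, cmod s < e ->
    (s * psum a s) ^+ 2 * psum g (s * psum a s) = s ^+ 2) ->
  exists2 d : R, 0 < d & forall t s, cmod t < d -> cmod s < d ->
    t ^+ 2 * psum g t = s ^+ 2 -> t = s * psum a s \/ t = - s * psum a (- s).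
Proof.
move=> [K [r Hg]] [Ka [ra Ha]] g0 a0 [e e0 He].
have r0 := proj1 Hg; have ra0 := proj1 Ha.
have K0 := geo_bounded_ge0 Hg; have Ka0 := geo_bounded_ge0 Ha.
rewrite -!cmod_gt0 in g0 a0.
(* A lower bound for |g(t)| on the disc where the Lipschitz bound keeps g(t) within [gam] of
   g(0). *)
pose gam := cmod (g 0%N) / 2; have gam0 : 0 < gam by rewrite divr_gt0.
pose Lg := 20 * K / r; have Lg0 : 0 <= Lg by rewrite divr_ge0 ?mulr_ge0 // ltW.
pose La := 20 * Ka / ra; have La0 : 0 <= La by rewrite divr_ge0 ?mulr_ge0 // ltW.
have Lgg : 0 <= Lg / gam by rewrite divr_ge0 // ltW.
pose M := 2 * Ka; have M0 : 0 <= M by rewrite mulr_ge0.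
pose A := 2 * La + 2 * (Lg / gam * M ^+ 2).
have A0 : 0 <= A.
  by rewrite addr_ge0 // mulr_ge0 // mulr_ge0 // exprn_ge0.
(* The last entry produces the contradiction: a third solution would give 2 |s| |a_0| <= A |s|^2,
   whereas (A + 1) |s| < |a_0|. The others keep all arguments within the discs of the estimates. *)
pose d := Num.min (Num.min (Num.min e (r / 4)) (Num.min (ra / 4) (gam / (Lg + 1))))
  (Num.min (r / (4 * (M + 1))) (cmod (a 0%N) / (A + 1))).
exists d; first by rewrite !lt_min e0 !divr_gt0 //; lra.
move=> t s; rewrite !lt_min => /andP[/andP[/andP[_ tr] /andP[_ tg]] _].
move=> /andP[/andP[/andP[se _] /andP[sra _]] /andP[sM sA]] Et.
have t0 := cmod_ge0 t; have s0 := cmod_ge0 s.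
have tr4 : 4 * cmod t <= r by lra.
have gt : gam <= cmod (psum g t).
  have h := psum_sub0_le Hg tr4; rewrite -/Lg cmodB in h.
  rewrite ltr_pdivlMr in tg; last lra.
  have := cmod_triangle (g 0%N) (psum g t) 0; rewrite !subr0.
  have gE : cmod (g 0%N) = 2 * gam by rewrite /gam; lra.
  nra.
(* At s = 0 the two known solutions coincide and nothing separates them; there t = 0 follows from
   g(t) being nonzero. *)
have [s_eq0|sN0] := eqVneq s 0.
  left; rewrite s_eq0 mul0r; rewrite s_eq0 expr0n /= in Et.
  move/eqP: Et; rewrite mulf_eq0 expf_eq0 /= => /orP[/eqP //|/eqP gt0].
  by move: gt; rewrite gt0 cmod0 leNgt gam0.
have [|tp] := eqVneq t (s * psum a s); first by left.
have [|tm] := eqVneq t (- s * psum a (- s)); first by right.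
exfalso.
have bnd x : cmod x = cmod s -> [/\ cmod (x * psum a x) <= M * cmod s,
    4 * cmod (x * psum a x) <= r,
    cmod (psum a x - a 0%N) <= La * cmod s &
    (x * psum a x) ^+ 2 * psum g (x * psum a x) = x ^+ 2].
  move=> xs; have h : cmod (x * psum a x) <= M * cmod s.
    rewrite cmodM xs mulrC ler_wpM2r //; apply: psum_le Ha _; lra.
  split=> //.
  - rewrite ltr_pdivlMr in sM; last lra.
    by nra.
  - by rewrite -xs; apply: psum_sub0_le Ha _; lra.
  - by apply: He; rewrite xs.
have [p1 p2 p3 p4] := bnd s erefl.
have [m1 m2 m3 m4] := bnd (- s) (cmodN s).
have Ep := square_branch_dichotomy Hg tr4 p2 gam0 gt (etrans Et (esym p4)) tp.
rewrite sqrrN in m4.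
have Em := square_branch_dichotomy Hg tr4 m2 gam0 gt (etrans Et (esym m4)) tm.
rewrite -/Lg in Ep Em.
have sq (x : R) : 0 <= x -> x <= M * cmod s ->
    Lg / gam * x ^+ 2 <= Lg / gam * (M ^+ 2 * cmod s ^+ 2).
  move=> x0 xM; rewrite ler_wpM2l // -exprMn lerXn2r // nnegrE //.
  by rewrite mulr_ge0.
have {}Ep := le_trans Ep (sq _ (cmod_ge0 _) p1).
have {}Em := le_trans Em (sq _ (cmod_ge0 _) m1).
have H1 := cmod_sub_of_sums Ep Em.
have H2 := cmod_odd_part_lower s (psum a s) (psum a (- s)) (a 0%N).
have H3 := le_trans H2 (lerD H1 (ler_wpM2l s0 (lerD p3 m3))).
rewrite ltr_pdivlMr in sA; last by rewrite ltr_wpDl.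
have sc : 0 < cmod s by rewrite cmod_gt0.
move: H3 sA sc A0; rewrite /A [Lg / gam * (M ^+ 2 * _)]mulrA.
move: (cmod s) (cmod (a 0%N)) (Lg / gam * M ^+ 2) (La).
clear; move=> sg al q La H3 sA sc A0.
have : sg * (2 * al) <= sg * ((2 * La + 2 * q) * sg) by lra.
rewrite ler_pM2l //; nra.
Qed.

End LocalBranch.

(** * Continuity of polynomial coefficients, and roots near a double root *)

Section CoalescingRoots.
Variable R : realType.
Local Notation C := (Cplx R).

Section Limits.
Variables (T : Type) (F : set_system T) (FF : Filter F).
Implicit Types (f g : T -> C) (a b : C).

Lemma cplx_cvg_cst a : (fun=> a) @ F --> a.
Proof. exact: cvg_cst. Qed.

Lemma cplx_cvgD f g a b : f @ F --> a -> g @ F --> b ->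
  (fun s => f s + g s) @ F --> a + b.
Proof. exact: cvgD. Qed.

Lemma cplx_cvgN f a : f @ F --> a -> (fun s => - f s) @ F --> - a.
Proof. exact: cvgN. Qed.

Lemma cplx_cvgM f g a b : f @ F --> a -> g @ F --> b ->
  (fun s => f s * g s) @ F --> a * b.
Proof. exact: cvgM. Qed.

Lemma cplx_cvg_sum n (f : 'I_n -> T -> C) (a : 'I_n -> C) :
  (forall i, f i @ F --> a i) ->
  (fun s => \sum_(i < n) f i s) @ F --> \sum_(i < n) a i.
Proof.
elim: n f a => [|n IH] f a fa.
  have -> : (fun s => \sum_(i < 0) f i s) = (fun=> 0).
    by apply/funext => s; rewrite big_ord0.
  by rewrite big_ord0; exact: cplx_cvg_cst.
have -> : (fun s => \sum_(i < n.+1) f i s) =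
    (fun s => f ord0 s + \sum_(i < n) f (lift ord0 i) s).
  by apply/funext => s; rewrite big_ord_recl.
by rewrite big_ord_recl; apply: cplx_cvgD (fa _) _; apply: IH.
Qed.

Lemma cplx_cvgX f a n : f @ F --> a -> (fun s => f s ^+ n) @ F --> a ^+ n.
Proof.
move=> fa; elim: n => [|n IH].
  have -> : (fun s => f s ^+ 0) = cst 1 by apply/funext => s; rewrite expr0.
  by rewrite expr0; exact: cplx_cvg_cst.
have -> : (fun s => f s ^+ n.+1) = (fun s => f s * f s ^+ n).
  by apply/funext => s; rewrite exprS.
by rewrite exprS; exact: cplx_cvgM.
Qed.

End Limits.

Definition coef_continuous (F : C -> {poly C}) :=
  forall k, (fun s => (F s)`_k) @ nbhs (0 : C) --> (F 0)`_k.

Lemma coef_continuousD F G : coef_continuous F -> coef_continuous G ->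
  coef_continuous (fun s => F s + G s).
Proof.
move=> hF hG k; rewrite coefD.
have -> : (fun s => (F s + G s)`_k) = (fun s => (F s)`_k + (G s)`_k).
  by apply/funext => s; rewrite coefD.
exact: cplx_cvgD (hF k) (hG k).
Qed.

Lemma coef_continuousN F : coef_continuous F -> coef_continuous (fun s => - F s).
Proof.
move=> hF k; rewrite coefN.
have -> : (fun s => (- F s)`_k) = (fun s => - (F s)`_k).
  by apply/funext => s; rewrite coefN.
exact: cplx_cvgN (hF k).
Qed.

Lemma coef_continuousM F G : coef_continuous F -> coef_continuous G ->
  coef_continuous (fun s => F s * G s).
Proof.
move=> hF hG k; rewrite coefM.
have -> : (fun s => (F s * G s)`_k) =
    (fun s => \sum_(i < k.+1) (F s)`_i * (G s)`_(k - i)).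
  by apply/funext => s; rewrite coefM.
by apply: cplx_cvg_sum => i; exact: cplx_cvgM (hF i) (hG (k - i)%N).
Qed.

Lemma coef_continuous_cst p : coef_continuous (fun=> p).
Proof. by move=> k; exact: cplx_cvg_cst. Qed.

Lemma coef_continuous_polyC (f : C -> C) : f @ nbhs (0 : C) --> f 0 ->
  coef_continuous (fun s => (f s)%:P).
Proof.
move=> hf [|k].
  rewrite coefC /=; have -> // : (fun s => (f s)%:P`_0) = f.
  by apply/funext => s; rewrite coefC.
rewrite coefC /=; have -> : (fun s => (f s)%:P`_k.+1) = (fun=> 0).
  by apply/funext => s; rewrite coefC.
exact: cplx_cvg_cst.
Qed.

Lemma coef_continuous_sum (I : Type) (r : seq I) (F : I -> C -> {poly C}) :
  (forall i, coef_continuous (F i)) ->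
  coef_continuous (fun s => \sum_(i <- r) F i s).
Proof.
move=> hF; elim: r => [|i r IH].
  have -> : (fun s => \sum_(i <- [::]) F i s) = (fun=> 0).
    by apply/funext => s; rewrite big_nil.
  exact: coef_continuous_cst.
have -> : (fun s => \sum_(j <- i :: r) F j s) =
    (fun s => F i s + \sum_(j <- r) F j s).
  by apply/funext => s; rewrite big_cons.
exact: (coef_continuousD (hF i) IH).
Qed.

Lemma coef_continuous_prod (I : Type) (r : seq I) (F : I -> C -> {poly C}) :
  (forall i, coef_continuous (F i)) ->
  coef_continuous (fun s => \prod_(i <- r) F i s).
Proof.
move=> hF; elim: r => [|i r IH].
  have -> : (fun s => \prod_(i <- [::]) F i s) = (fun=> 1).
    by apply/funext => s; rewrite big_nil.
  exact: coef_continuous_cst.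
have -> : (fun s => \prod_(j <- i :: r) F j s) =
    (fun s => F i s * \prod_(j <- r) F j s).
  by apply/funext => s; rewrite big_cons.
exact: (coef_continuousM (hF i) IH).
Qed.

Lemma coef_continuous_char_poly n (M : C -> 'M[C]_n) :
  (forall i j, (fun s => M s i j) @ nbhs (0 : C) --> M 0 i j) ->
  coef_continuous (fun s => char_poly (M s)).
Proof.
move=> hM; rewrite /char_poly /determinant; apply: coef_continuous_sum => sg.
apply: coef_continuousM; first exact: coef_continuous_cst.
apply: coef_continuous_prod => i.
have -> : (fun s => char_poly_mx (M s) i (sg i)) =
   (fun s => ('X *+ (i == sg i)) + - (M s i (sg i))%:P).
  by apply/funext => s; rewrite !mxE.
apply: coef_continuousD; first exact: coef_continuous_cst.
by apply: coef_continuousN; apply: coef_continuous_polyC; exact: hM.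
Qed.

Lemma near_eq_cvg0 (f g : C -> C) (l : C) :
  (\forall s \near (0 : C), f s = g s) -> g @ nbhs (0 : C) --> l ->
  f @ nbhs (0 : C) --> l.
Proof.
move=> fg /cvg_cmodP gl; apply/cvg_cmodP => e /gl.
by apply: filterS2 fg => s ->.
Qed.

(* Comparing coefficients from the top gives
   [q`_k = p`_k.+2 + (x + y) * q`_k.+1 - x * y * q`_k.+2]. *)
Lemma coef_continuous_quotient (p q : C -> {poly C}) (x y : C -> C) n :
  (\forall s \near (0 : C), p s = q s * (('X - (x s)%:P) * ('X - (y s)%:P))) ->
  (forall s, (size (q s) <= n)%N) -> coef_continuous p ->
  x @ nbhs (0 : C) --> x 0 -> y @ nbhs (0 : C) --> y 0 -> coef_continuous q.
Proof.
move=> pq qn hp hx hy.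
have rec s : p s = q s * (('X - (x s)%:P) * ('X - (y s)%:P)) -> forall k,
   (q s)`_k = (p s)`_k.+2 + (x s + y s) * (q s)`_k.+1 - x s * y s * (q s)`_k.+2.
  move=> -> k.
  have -> : q s * (('X - (x s)%:P) * ('X - (y s)%:P)) =
     q s * 'X^2 - (x s + y s) *: (q s * 'X) + (x s * y s) *: q s.
    by rewrite -!mul_polyC polyCM polyCD; ring.
  by rewrite coefD coefB !coefZ coefMX coefMXn /= subn2 /=; ring.
(* Downward induction on [k], measured by [n - k]: coefficients of index at least [n] vanish by the
   size bound. *)
suff H j : forall k, (n - k <= j)%N -> (fun s => (q s)`_k) @ nbhs (0 : C) --> (q 0)`_k.
  by move=> k; apply: (H n); exact: leq_subr.
elim: j => [|j IH] k.
  rewrite leqn0 subn_eq0 => nk.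
  have q0 s : (q s)`_k = 0 by rewrite nth_default // (leq_trans (qn s)).
  have -> : (fun s => (q s)`_k) = (fun=> 0) by apply/funext => s; exact: q0.
  by rewrite q0; exact: cplx_cvg_cst.
move=> nk.
have IH1 : (fun s => (q s)`_k.+1) @ nbhs (0 : C) --> (q 0)`_k.+1.
  by apply: IH; rewrite subnS -subn1 leq_subLR add1n.
have IH2 : (fun s => (q s)`_k.+2) @ nbhs (0 : C) --> (q 0)`_k.+2.
  apply: IH; apply: leq_trans (leq_sub2l n (leqnSn k.+1)) _.
  by rewrite subnS -subn1 leq_subLR add1n.
rewrite (rec 0 (nbhs_singleton pq)).
apply: near_eq_cvg0; first by apply: filterS pq => s /rec; apply.
apply: cplx_cvgD; last first.
  by apply: cplx_cvgN; apply: cplx_cvgM IH2; exact: cplx_cvgM hx hy.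
by apply: cplx_cvgD (hp _) _; apply: cplx_cvgM IH1; exact: cplx_cvgD hx hy.
Qed.

(** The uniform size bound makes the value a fixed finite sum, jointly continuous in [s] and [x];
    hence the product filter and a common radius. *)
Lemma horner_neq0_near (q : C -> {poly C}) (x0 : C) n : coef_continuous q ->
  (forall s, (size (q s) <= n)%N) -> (q 0).[x0] != 0 ->
  exists2 d : R, 0 < d & forall s x, cmod s < d -> cmod (x - x0) < d ->
    (q s).[x] != 0.
Proof.
move=> hq qn q0.
pose F := filter_prod (nbhs (0 : C)) (nbhs x0).
have c1 : (fun u : C * C => \sum_(k < n) (q u.1)`_k * u.2 ^+ k) @ F -->
    \sum_(k < n) (q 0)`_k * x0 ^+ k.
  apply: cplx_cvg_sum => k; apply: cplx_cvgM.
    apply: (@cvg_comp _ _ _ fst (fun s => (q s)`_k)); last exact: hq.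
    exact: cvg_fst.
  by apply: cplx_cvgX; exact: cvg_snd.
rewrite (horner_coef_wide _ (qn 0)) -cmod_gt0 in q0.
move/cvg_cmodP: c1 => /(_ _ q0) [[P Q] /= [/nbhs_cmodP [e e0 He] /nbhs_cmodP [f f0 Hf]] PQ].
exists (Num.min e f); first by rewrite lt_min e0.
move=> s x; rewrite !lt_min => /andP[se _] /andP[_ xf].
rewrite (horner_coef_wide _ (qn s)).
have Ps : P s by apply: He; rewrite subr0.
have := PQ (s, x) (conj Ps (Hf x xf)); rewrite /= => h.
by apply: contraTneq h => ->; rewrite sub0r cmodN ltxx.
Qed.

Lemma coalescing_roots (p : C -> {poly C}) (x : C -> C) n :
  coef_continuous p -> (forall s, size (p s) = n.+1) -> mup (x 0) (p 0) = 2%N ->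
  x @ nbhs (0 : C) --> x 0 ->
  (\forall s \near (0 : C), root (p s) (x s) /\ root (p s) (x (- s))) ->
  (\forall s \near (0 : C), s != 0 -> x s != x (- s)) ->
  exists2 d : R, 0 < d & forall s z, cmod s < d -> cmod (z - x 0) < d ->
    root (p s) z -> z = x s \/ z = x (- s).
Proof.
move=> hp pn mup2 hx rx xs.
have hy : (fun s => x (- s)) @ nbhs (0 : C) --> x (- 0).
  rewrite oppr0; apply: (@cvg_comp _ _ _ (fun s : C => - s) x _ _ _ _ hx).
  apply/cvg_cmodP => e e0; apply/nbhs_cmodP; exists e => // s.
  by rewrite !subr0 cmodN.
pose m s := ('X - (x s)%:P) * ('X - (x (- s))%:P).
have p0 s : p s != 0 by rewrite -size_poly_gt0 pn.
have pE : \forall s \near (0 : C), p s = p s %/ m s * m s.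
  apply: filterS2 rx xs => s [r1 r2] xs; rewrite divpK //.
  (* At 0 both linear factors coincide and multiplicity two supplies the square; elsewhere they are
     coprime, so their product divides. *)
  have [->|s0] := eqVneq s 0.
    by rewrite /m oppr0 -expr2 -mup_geq ?mup2.
  rewrite /m Gauss_dvdp ?dvdp_XsubCl ?r1 //.
  by rewrite coprimep_XsubC2 // subr_eq0 eq_sym xs.
have qn s : (size (p s %/ m s)%R <= n.+1)%N by rewrite -(pn s) leq_divp.
have hq := coef_continuous_quotient pE qn hp hx hy.
(* A zero here would be a third factor at [x 0], against multiplicity two. *)
have q0 : (p 0 %/ m 0).[x 0] != 0.
  apply/negP => rq.
  have /factor_theorem [q' q'E] : root (p 0 %/ m 0) (x 0) by [].
  have : ('X - (x 0)%:P) ^+ 3 %| p 0.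
    rewrite (nbhs_singleton pE) q'E /m oppr0 -expr2 -mulrA -exprS.
    exact: dvdp_mull.
  by rewrite -mup_geq // mup2.
have [d d0 Hd] := horner_neq0_near hq qn q0.
move/nbhs_cmodP: pE => [e e0 He].
exists (Num.min d e); first by rewrite lt_min d0.
move=> s z; rewrite !lt_min => /andP[sd se] /andP[zd _].
rewrite He ?subr0 // rootM => /orP[|].
  by move=> rz; have := Hd s z sd zd; rewrite (eqP rz) eqxx.
by rewrite rootM !root_XsubC => /orP[] /eqP ->; [left | right].
Qed.

End CoalescingRoots.

(** * From the local branch to elimination, coalescence and the expansion *)

Section Branches.
Variable R : realType.
Local Notation C := (Cplx R).
Implicit Types (a b c : nat -> C) (K r : R).

Lemma series2 (u : nat -> C) : series u 2 = u 0%N + u 1%N.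
Proof. by rewrite /series /= big_nat_recr // big_nat1. Qed.

(** The difference of the two values is 2 c_1 s up to two tails of order s^2, so equality would
    bound |s| below. *)
Lemma psum_odd_separation c K r : geo_bounded c K r -> c 1%N != 0 ->
  \forall s \near (0 : C), s != 0 -> psum c s != psum c (- s).
Proof.
move=> Hc c1; have r0 := proj1 Hc; have K0 := geo_bounded_ge0 Hc.
rewrite -cmod_gt0 in c1; have r20 : 0 < r ^+ 2 by rewrite exprn_gt0.
apply/nbhs_cmodP; exists (Num.min (r / 2) (cmod (c 1%N) * r ^+ 2 / (2 * K + 1))).
  by rewrite lt_min !divr_gt0 ?mulr_gt0 //; lra.
move=> s; rewrite subr0 lt_min => /andP[s1 s2] s0; apply/negP => /eqP Ls.
have sr : 2 * cmod s <= r by lra.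
have srN : 2 * cmod (- s) <= r by rewrite cmodN.
have := psum_tail 2 Hc sr; have := psum_tail 2 Hc srN; rewrite -Ls cmodN.
set E := 2 * K * _ => h1 h2.
have : cmod (2%:R * (c 1%N * s)) <= E + E.
  have -> : 2%:R * (c 1%N * s) = (psum c s - series (fun k => c k * (- s) ^+ k) 2) -
     (psum c s - series (fun k => c k * s ^+ k) 2).
    rewrite !series2 !expr0 !expr1.
    by move: (psum c s) (c 0%N) (c 1%N) (s) => L u v t; ring.
  by apply: le_trans (cmodD _ _) _; rewrite cmodN lerD.
rewrite cmodM cmod_natr cmodM /E; move: s0; rewrite -cmod_gt0.
move: s2; rewrite ltr_pdivlMr; last by lra.
rewrite expr_div_n; move: r20 c1; move: (r ^+ 2) (cmod (c 1%N)) (cmod s) K0.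
clear; move=> q al sg K0 q0 al0 hs sg0.
have -> : 2 * K * (sg ^+ 2 / q) = (2 * K * sg ^+ 2) / q by rewrite mulrA.
rewrite -mulrDl ler_pdivlMr //.
have -> : 2 * (al * sg) * q = sg * (2 * (al * q)) by ring.
have -> : 2 * K * sg ^+ 2 + 2 * K * sg ^+ 2 = sg * (2 * (2 * K * sg)) by ring.
by rewrite ler_pM2l //; nra.
Qed.

Lemma psum_taylor_bigO c K r : geo_bounded c K r ->
  (fun s : C => psum c s - (c 0%N + c 1%N * s + c 2%N * s ^+ 2))
    =O_ (nbhs (0 : C)) (fun s => s ^+ 3).
Proof.
move=> Hc; have r0 := proj1 Hc; have K0 := geo_bounded_ge0 Hc.
apply/eqO_exP; exists (((2 * K / r ^+ 3 + 1)%:C)%C : C).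
  rewrite ltcR ltr_wpDl //; apply: divr_ge0; first by rewrite mulr_ge0.
  by rewrite exprn_ge0 // ltW.
apply/nbhs_cmodP; exists (r / 2); first by rewrite divr_gt0.
move=> s; rewrite subr0 => sr; have s0 := cmod_ge0 s.
have sr2 : 2 * cmod s <= r by lra.
have := psum_tail 3 Hc sr2.
have -> : series (fun k => c k * s ^+ k) 3 = c 0%N + c 1%N * s + c 2%N * s ^+ 2.
  by rewrite /series /= !big_nat_recr //= !big_nil add0r expr0 mulr1 expr1.
rewrite !cmodE -rmorphM lecR => /le_trans; apply.
rewrite cmodX expr_div_n mulrCA mulrC; apply: ler_wpM2r.
  by rewrite exprn_ge0.
by rewrite lerDl.
Qed.

Lemma psum_continuous_at0 a K r : geo_bounded a K r ->
  psum a @ nbhs (0 : C) --> psum a 0.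
Proof.
move=> Ha; have r0 := proj1 Ha; have K0 := geo_bounded_ge0 Ha.
rewrite (psum_at0 Ha); apply/cvg_cmodP => e e0; apply/nbhs_cmodP.
have L0 : 0 < 20 * K / r + 1 by rewrite ltr_wpDl // divr_ge0 ?mulr_ge0 // ltW.
exists (Num.min (r / 4) (e / (20 * K / r + 1))).
  by rewrite lt_min !divr_gt0.
move=> s; rewrite subr0 lt_min => /andP[s1 s2]; have s0 := cmod_ge0 s.
have s4 : 4 * cmod s <= r by lra.
apply: le_lt_trans (psum_sub0_le Ha s4) _.
rewrite ltr_pdivlMr // mulrC in s2; apply: le_lt_trans s2.
by rewrite ler_wpM2r // lerDl.
Qed.

Lemma has_psum_continuous (f : C -> C) z0 a : has_psum f z0 a ->
  f @ nbhs z0 --> f z0.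
Proof.
move=> Hf; have fz0 := has_psum_at Hf; move: Hf => [K [r [Ha fE]]].
have r0 := proj1 Ha; rewrite fz0 -(psum_at0 Ha).
have /cvg_cmodP H := psum_continuous_at0 Ha.
apply/cvg_cmodP => e /H /nbhs_cmodP [d d0 Hd]; apply/nbhs_cmodP.
exists (Num.min d (r / 2)); first by rewrite lt_min d0 divr_gt0.
move=> z; rewrite lt_min => /andP[z1 z2]; rewrite fE; last by lra.
by apply: Hd; rewrite subr0.
Qed.

Lemma elimination_of_local_branch (D : set C) (lambda rho : C -> C) (mu : C)
    a b c : nbhs mu D -> has_psum rho mu b -> b 1%N = 0 -> b 2%N != 0 ->
  (exists K r, geo_bounded a K r) -> a 0%N != 0 ->
  (exists2 e : R, 0 < e & forall s, cmod s < e ->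
     [/\ (s * psum a s) ^+ 2 * psum (fun k => b k.+2) (s * psum a s) = s ^+ 2,
         rho (mu + s * psum a s) = rho mu + s ^+ 2 &
         lambda (mu + s * psum a s) = psum c s]) ->
  elimination_branches D lambda rho mu (psum c).
Proof.
move=> nD Hrho b1 b2 Ha a0 [e e0 He]; have rho0 := has_psum_at Hrho.
case: Hrho => Kb [rb [Hb bE]]; have rb0 := proj1 Hb.
have Hg := geo_bounded_shift (geo_bounded_shift Hb).
have [||d d0 Hd] := @square_branch_unique _ (fun k => b k.+2) a _ Ha b2 a0.
- by exists (Kb / rb / rb), rb.
- by exists e => // s /He [].
case: Ha => Ka [ra Ha]; have ra0 := proj1 Ha; have Ka0 := geo_bounded_ge0 Ha.
have m0 : 0 < Num.min d (rb / 2) by rewrite lt_min d0 divr_gt0.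
(* On this disc both the expansion of [rho] and the uniqueness of solutions are available. *)
exists (D `&` [set z | cmod (z - mu) < Num.min d (rb / 2)]); split.
- apply: filterI => //; apply/nbhs_cmodP.
  by exists (Num.min d (rb / 2)).
- by move=> z [].
move=> V /nbhs_cmodP [eV eV0 HV] VV0.
pose M := 2 * Ka; have M0 : 0 <= M by rewrite mulr_ge0.
apply/nbhs_cmodP.
(* The entry with [eV] depends on [V]: it puts both solutions mu + phi(s) and mu + phi(- s) into
   [V], since |phi(s)| <= M |s|. *)
exists (Num.min (Num.min d e) (Num.min (ra / 2) (eV / (M + 1)))).
  by rewrite !lt_min d0 e0 !divr_gt0 //; lra.
move=> s; rewrite subr0 !lt_min => /andP[/andP[sd se] /andP[sra sM]].
have inV x : cmod x = cmod s -> V (mu + x * psum a x).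
  move=> xs; apply: HV; rewrite addrC addKr cmodM xs.
  have xr : 2 * cmod x <= ra by rewrite xs; lra.
  rewrite ltr_pdivlMr in sM; last lra.
  apply: le_lt_trans sM; apply: ler_wpM2l; first exact: cmod_ge0.
  by apply: le_trans (psum_le Ha xr) _; rewrite lerDl.
have [_ rs ls] := He s se.
have seN : cmod (- s) < e by rewrite cmodN.
have [_ rsN lsN] := He (- s) seN; rewrite sqrrN in rsN.
apply/seteqP; split => [z [x [Vx rx] <-]|z [->|->]]; last 2 first.
- exists (mu + s * psum a s); last exact: ls.
  by split; [exact: inV | exact: rs].
- exists (mu + - s * psum a (- s)); last exact: lsN.
  by split; [exact: inV (cmodN s) | exact: rsN].
have [_ /=] := VV0 x Vx; rewrite lt_min => /andP[xd xr].
have xr2 : 2 * cmod (x - mu) <= rb by lra.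
have xE : mu + (x - mu) = x by rewrite addrC subrK.
(* Any preimage in [V] solves the square equation, so uniqueness leaves only phi(s) and phi(- s). *)
have : (x - mu) ^+ 2 * psum (fun k => b k.+2) (x - mu) = s ^+ 2.
  have : rho x = rho mu + s ^+ 2 := rx.
  rewrite rho0 (bE x xr2) (psum_shift Hb xr2).
  rewrite (psum_shift (geo_bounded_shift Hb) xr2) b1 add0r => /addrI <-.
  by rewrite expr2 mulrA.
case/(Hd _ _ xd sd) => E; rewrite -xE E; [left | right].
  exact: ls.
exact: lsN.
Qed.

Lemma coalescing_of_local_branch n (A : C -> 'M[C]_n) (rho_c : C)
    (c : nat -> C) K r :
  (forall i j, exists a, has_psum (fun z => A z i j) rho_c a) ->
  alg_mult (A rho_c) (c 0%N) = 2%N -> geo_bounded c K r -> c 1%N != 0 ->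
  (\forall s \near (0 : C), eigenvalue (A (rho_c + s ^+ 2)) (psum c s)) ->
  coalescing_eigenvalues A rho_c (c 0%N) (psum c).
Proof.
move=> HA mult2 Hc c1 eig.
have Lc := psum_continuous_at0 Hc; have L0 := psum_at0 Hc.
have sep := psum_odd_separation Hc c1.
split; last first.
  move/nbhs_cmodP: sep => [e e0 He]; apply/dnbhs_cmodP; exists e => // s s0 se.
  exact: He.
(* The matrix depends on s through s^2 alone, so exchanging s and - s yields the second
   eigenvalue. *)
have eigN : \forall s \near (0 : C), eigenvalue (A (rho_c + s ^+ 2)) (psum c (- s)).
  move/nbhs_cmodP: eig => [e e0 He]; apply/nbhs_cmodP; exists e; first exact: e0.
  by move=> s; rewrite subr0 => se; rewrite -(sqrrN s); apply: He; rewrite subr0 cmodN.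
have z0 : rho_c + 0 ^+ 2 = rho_c by rewrite expr0n addr0.
have sq0 : (fun s : C => rho_c + s ^+ 2) @ nbhs (0 : C) --> rho_c.
  rewrite -[X in _ --> X]z0; apply: cplx_cvgD; first exact: cplx_cvg_cst.
  by apply: cplx_cvgX; exact: cvg_id.
have hp : coef_continuous (fun s => char_poly (A (rho_c + s ^+ 2))).
  apply: coef_continuous_char_poly => i j; rewrite z0.
  have [a Ha] := HA i j.
  exact: (@cvg_comp _ _ _ (fun s : C => rho_c + s ^+ 2) (fun z => A z i j)
            _ _ _ sq0 (has_psum_continuous Ha)).
have rts : \forall s \near (0 : C),
    root (char_poly (A (rho_c + s ^+ 2))) (psum c s) /\
    root (char_poly (A (rho_c + s ^+ 2))) (psum c (- s)).
  apply: filterS2 eig eigN => s e1 e2.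
  by split; rewrite -eigenvalue_root_char; [exact: e1 | exact: e2].
have sz s : size (char_poly (A (rho_c + s ^+ 2))) = n.+1 by exact: size_char_poly.
have m2 : mup (psum c 0) (char_poly (A (rho_c + 0 ^+ 2))) = 2%N.
  by rewrite z0 L0; exact: mult2.
have [d d0 Hd] := coalescing_roots hp sz m2 Lc rts sep.
rewrite L0 in Hd Lc.
exists [set z | cmod (z - c 0%N) < d]; split.
  by apply/nbhs_cmodP; exists d.
move=> W nW WW0.
have LW : \forall s \near (0 : C), W (psum c s) by exact: Lc.
have LWN : \forall s \near (0 : C), W (psum c (- s)).
  move/nbhs_cmodP: LW => [e e0 He]; apply/nbhs_cmodP; exists e; first exact: e0.
  by move=> s; rewrite subr0 => se; apply: He; rewrite subr0 cmodN.
have small : \forall s \near (0 : C), cmod s < d.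
  by apply/nbhs_cmodP; exists d => // s; rewrite subr0.
apply: filterS (filterI (filterI LW LWN) (filterI (filterI eig eigN) small)).
move=> s [[W1 W2] [[e1 e2] sd]].
apply/seteqP; split => [z [Wz /= ez]|z [->|->]].
- apply: (Hd s z sd (WW0 _ Wz)).
  by rewrite -eigenvalue_root_char; exact: ez.
- exact (conj W1 e1).
- exact (conj W2 e2).
Qed.

End Branches.

(** * Identification of the Taylor coefficients with the given derivatives, and conclusion *)

Theorem theorem4p4 (R : realType) (n : nat)
    (U D : set (Cplx R)) (A : Cplx R -> 'M[Cplx R]_n)
    (rho lambda : Cplx R -> Cplx R) (mu_c rho_c lambda_c : Cplx R)
    (lambda_c1 lambda_c2 rho_c1 rho_c2 rho_c3 : Cplx R)
    (U_open : open U)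
    (A_analytic : forall i j, analytic_on (fun z => A z i j) U)
    (D_region : region D)
    (rho_D_U : forall mu, D mu -> U (rho mu))
    (rho_analytic : analytic_on rho D)
    (lambda_analytic : analytic_on lambda D)
    (lambda_eigenvalue : forall mu, D mu -> eigenvalue (A (rho mu)) (lambda mu))
    (D_mu_c : D mu_c)
    (rho_cE : rho_c = rho mu_c)
    (lambda_cE : lambda_c = lambda mu_c)
    (lambda_c_double : alg_mult (A rho_c) lambda_c = 2%N)
    (lambda_c1E : lambda_c1 = derive1 lambda mu_c)
    (lambda_c2E : lambda_c2 = derive1n 2 lambda mu_c)
    (rho_c1E : rho_c1 = derive1 rho mu_c)
    (rho_c2E : rho_c2 = derive1n 2 rho mu_c)
    (rho_c3E : rho_c3 = derive1n 3 rho mu_c)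
    (lambda_c1_neq0 : lambda_c1 != 0)
    (rho_c1_eq0 : rho_c1 = 0)
    (rho_c2_neq0 : rho_c2 != 0) :
  forall w : Cplx R, w ^+ 2 = 2 / rho_c2 ->
  let alpha := lambda_c1 * w in
  let beta := (3 * lambda_c2 * rho_c2 - lambda_c1 * rho_c3) / (3 * rho_c2 ^+ 2) in
  alpha != 0 /\
  exists L : Cplx R -> Cplx R,
    [/\ analytic_at L 0,
        elimination_branches D lambda rho mu_c L,
        coalescing_eigenvalues A rho_c lambda_c L &
        (fun s => L s - (lambda_c + alpha * s + beta * s ^+ 2))
          =O_ (nbhs (0 : Cplx R)) (fun s => s ^+ 3)].
Proof.
move=> w wE alpha beta.
have w0 : w != 0.
  apply/eqP => w0; move/eqP: wE; rewrite w0 expr0n /= eq_sym.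
  by rewrite mulf_eq0 invr_eq0 (negPf rho_c2_neq0) orbF pnatr_eq0.
have alpha0 : alpha != 0 by rewrite mulf_neq0.
split=> //.
have nD : nbhs mu_c D by apply: open_nbhs_nbhs; split => //; case: D_region.
have [b Hb] := analytic_at_has_psum (rho_analytic _ D_mu_c).
have [l Hl] := analytic_at_has_psum (lambda_analytic _ D_mu_c).
have b1E : rho_c1 = b 1%N.
  by rewrite rho_c1E -[derive1 rho]derive1n1 (has_psum_derive1n 1 Hb) mul1r.
have l1E : lambda_c1 = l 1%N.
  by rewrite lambda_c1E -[derive1 lambda]derive1n1 (has_psum_derive1n 1 Hl) mul1r.
have b2E : rho_c2 = 2 * b 2%N by rewrite rho_c2E (has_psum_derive1n 2 Hb).
have l2E : lambda_c2 = 2 * l 2%N by rewrite lambda_c2E (has_psum_derive1n 2 Hl).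
have b3E : rho_c3 = 6 * b 3%N by rewrite rho_c3E (has_psum_derive1n 3 Hb).
have l0E : lambda_c = l 0%N by rewrite lambda_cE (has_psum_at Hl).
have b20 : b 2%N != 0.
  by apply: contra_neq rho_c2_neq0 => b20; rewrite b2E b20 mulr0.
have bw : b 2%N * w ^+ 2 = 1 by rewrite wE b2E; field.
have b1 : b 1%N = 0 by rewrite -b1E.
have [a [c [Ha [K [r Hc]] a0 [c0 c1 c2] He]]] := local_branch Hb Hl b1 bw.
have c1E : c 1%N = alpha by rewrite c1 /alpha l1E.
have c0E : c 0%N = lambda_c by rewrite c0 l0E.
(* With w^2 = 1 / b_2 the coefficient is l_2 / b_2 - l_1 b_3 / (2 b_2^2); the factorials 2 and 6 in
   the derivatives turn it into beta. *)
have c2E : c 2%N = beta.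
  rewrite c2 /beta l1E l2E b2E b3E.
  have -> : w ^+ 4 = (w ^+ 2) ^+ 2 by rewrite -exprM.
  have -> : w ^+ 2 = (b 2%N)^-1 by rewrite wE b2E; field.
  by field.
have hA i j : exists a', has_psum (fun z => A z i j) rho_c a'.
  apply: analytic_at_has_psum; apply: A_analytic.
  by rewrite rho_cE; exact: rho_D_U.
have mult2 : alg_mult (A rho_c) (c 0%N) = 2%N by rewrite c0E.
have c1N0 : c 1%N != 0 by rewrite c1E.
have a0N0 : a 0%N != 0 by rewrite a0.
(* For small s the point mu_c + s v(s) lies in [D], where the eigenvalue hypothesis applies; [rho]
   and [lambda] take there the values rho_c + s^2 and L(s). *)
have eig : \forall s \near (0 : Cplx R),
    eigenvalue (A (rho_c + s ^+ 2)) (psum c s).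
  case: He => e e0 He; case: Ha => Ka [ra Ha].
  move/nbhs_cmodP: nD => [eD eD0 HD].
  have sa : (fun s => s * psum a s) @ nbhs (0 : Cplx R) --> 0 * psum a 0.
    by apply: cplx_cvgM; [exact: cvg_id | exact: psum_continuous_at0 Ha].
  rewrite mul0r in sa; move/cvg_cmodP: sa => /(_ eD eD0).
  have : \forall s \near (0 : Cplx R), cmod s < e.
    by apply/nbhs_cmodP; exists e => // s; rewrite subr0.
  apply: filterS2 => s se; rewrite subr0 => sD.
  have [_ rs ls] := He s se.
  rewrite rho_cE -rs -ls; apply: lambda_eigenvalue; apply: HD.
  by rewrite addrC addKr.
exists (psum c); split.
- exact: psum_analytic_at Hc.
- exact: elimination_of_local_branch nD Hb b1 b20 Ha a0N0 He.
- rewrite -c0E; exact: coalescing_of_local_branch hA mult2 Hc c1N0 eig.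
- rewrite -c0E -c1E -c2E; exact: psum_taylor_bigO Hc.
Qed.
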